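(* Let $\sigma>0$, let $F:\mathcal{P}(\mathbb{R}^d)\to\mathbb{R}$ admit first and second order flat derivatives $\frac{\delta F}{\delta m}$ and $\frac{\delta^2 F}{\delta m^2}$, and suppose: (i) $F$ is convex, i.e. $F(m)-F(m')\le\int_{\mathbb{R}^d}\frac{\delta F}{\delta m}(m,x)(m-m')(dx)$ for all $m,m'\in\mathcal{P}(\mathbb{R}^d)$; (ii) there is $C>0$ with $\left|\frac{\delta F}{\delta m}(m,x)\right|\le C$ for all $m\in\mathcal{P}(\mathbb{R}^d)$, $x\in\mathbb{R}^d$; (iii) there is $C_2>0$ with $\left|\frac{\delta^2 F}{\delta m^2}(m,x,y)\right|\le C_2$ for all $m\in\mathcal{P}(\mathbb{R}^d)$, $x,y\in\mathbb{R}^d$. Let $\pi(dx)\propto\exp\left(-\frac{2}{\sigma^2}U(x)\right)dx$ be an absolutely continuous probability measure with potential $U:\mathbb{R}^d\to\mathbb{R}$, and let $m_0\in\mathcal{P}(\mathbb{R}^d)$ be absolutely continuous and such that, for some constant $R>1$, $\sup_{x\in\mathbb{R}^d}\frac{m_0(x)}{\pi(x)}\le R$. Then the birth-death equation $$\partial_t m_t(x)=-\left(\frac{\delta F}{\delta m}(m_t,x)+\frac{\sigma^2}{2}\log\left(\frac{m_t(x)}{\pi(x)}\right)-\frac{\sigma^2}{2}\operatorname{KL}(m_t|\pi)\right)m_t(x)$$ with initial condition $m_0$ has a unique solution $(m_t)_{t\ge0}$. Moreover, for all $t\ge0$, $$\operatorname{KL}(m_t|\pi)\le 2\log R+\frac{4C}{\sigma^2},$$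 and there exists a constant $R_1>1$ such that for all $t\ge0$, $\sup_{x\in\mathbb{R}^d}\frac{m_t(x)}{\pi(x)}\le R_1$. If additionally there exists a constant $r>0$ such that $\inf_{x\in\mathbb{R}^d}\frac{m_0(x)}{\pi(x)}\ge r$, then there exists a constant $r_1>0$ such that for all $t\ge0$, $\inf_{x\in\mathbb{R}^d}\frac{m_t(x)}{\pi(x)}\ge r_1$.
   Context: $\mathcal{P}(\mathbb{R}^d)$ is the space of Borel probability measures on $\mathbb{R}^d$; an absolutely continuous (with respect to Lebesgue measure) probability measure $m$ is identified with its density $x\mapsto m(x)$. KL-divergence: $\operatorname{KL}(m|\pi)=\int_{\mathbb{R}^d}\log\left(\frac{m(x)}{\pi(x)}\right)m(x)\,dx$ if $m$ is absolutely continuous with respect to $\pi$, and $+\infty$ otherwise. Flat derivative: $G:\mathcal{P}(\mathbb{R}^d)\to\mathbb{R}$ admits a (first order) flat derivative if there is a functional $\frac{\delta G}{\delta m}:\mathcal{P}(\mathbb{R}^d)\times\mathbb{R}^d\to\mathbb{R}$ such that (1) for every $a\in\mathbb{R}^d$, $m\mapsto\frac{\delta G}{\delta m}(m,a)$ is continuous (for the weak topology); (2) for every $m$, $a\mapsto\frac{\delta G}{\delta m}(m,a)$ is bounded; (3) for all $m,m'\in\mathcal{P}(\mathbb{R}^d)$, $G(m')-G(m)=\int_0^1\int_{\mathbb{R}^d}\frac{\delta G}{\delta m}(m+\lambda(m'-m),a)(m'-m)(da)\,d\lambda$. It is defined only up to an additive constant (in $a$), and is always normalized by $\int_{\mathbb{R}^d}\frac{\delta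 G}{\delta m}(m,x)\,m(dx)=0$. $F$ admits a second order flat derivative $\frac{\delta^2F}{\delta m^2}:\mathcal{P}(\mathbb{R}^d)\times\mathbb{R}^d\times\mathbb{R}^d\to\mathbb{R}$ if for each $a\in\mathbb{R}^d$ the functional $m\mapsto\frac{\delta F}{\delta m}(m,a)$ admits a flat derivative $\frac{\delta^2F}{\delta m^2}(m,\cdot,a)$; so $\frac{\delta F}{\delta m}(m',a)-\frac{\delta F}{\delta m}(m,a)=\int_0^1\int_{\mathbb{R}^d}\frac{\delta^2F}{\delta m^2}(m+\lambda(m'-m),a',a)(m'-m)(da')\,d\lambda$. A solution $(m_t)_{t\ge0}$ is a family of absolutely continuous probability measures, equal to $m_0$ at $t=0$, whose densities satisfy the equation for $t\ge0$ and $x\in\mathbb{R}^d$ (in particular $\operatorname{KL}(m_t|\pi)<\infty$). The expression $s\log s$ is read as $0$ at $s=0$. *)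

(* Defs.v *)
From HB Require Import structures.
From mathcomp Require Import all_boot all_order all_algebra.
From mathcomp Require Import all_classical all_reals all_analysis.
From mathcomp Require Import measurable_realfun.

Set Implicit Arguments.
Unset Strict Implicit.
Unset Printing Implicit Defensive.

Import Order.TTheory GRing.Theory Num.Theory.
Import numFieldNormedType.Exports.

Local Open Scope classical_set_scope.
Local Open Scope ring_scope.

Section euclidean_space.
Variable R : realType.

(* The Borel sigma-algebra of R^d. The carrier is convertible to 'rV[R]_d, whose
   topology is the usual one. *)
Definition Rd (d : nat) := g_sigma_algebraType (@open 'rV[R]_d).

Lemma open_measurable_Rd d (A : set 'rV[R]_d) :
  open A -> measurable (A : set (Rd d)).
Proof. exact: sub_sigma_algebra. Qed.

Lemma measurable_coord d (i : 'I_d) :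
  measurable_fun setT (fun v : Rd d => (v : 'rV[R]_d) ord0 i).
Proof.
apply: (measurability _ (RGenOpens.measurableE R)).
move=> _ [_ [a [b ->]] <-]; rewrite setTI.
apply: open_measurable_Rd.
have: continuous (fun v : 'rV[R]_d => v ord0 i) by exact: coord_continuous.
by move=> /continuousP; apply; apply: interval_open.
Qed.

Lemma measurable_rowP d0 (T : measurableType d0) d (f : T -> Rd d) :
  (forall i, measurable_fun setT (fun t => (f t : 'rV[R]_d) ord0 i)) ->
  measurable_fun setT f.
Proof.
move=> mf; apply: (@measurability _ _ _ (Rd d) _ _ (@open 'rV[R]_d)); first by [].
move=> _ [U oU <-]; rewrite setTI.
pose B (p : 'rV[rat]_d * nat) : set 'rV[R]_d :=
  [set v | forall i, `|v ord0 i - ratr (p.1 ord0 i)| < p.2.+1%:R^-1].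
have -> : U = \bigcup_(p in [set p | B p `<=` U]) B p.
  apply/seteqP; split=> [v Uv|v [p /= pU Bv]]; last exact: pU.
  have /nbhs_ballP[e /= e0 eU] : nbhs v U by exact: open_nbhs_nbhs.
  have e20 : 0 < e / 2 by rewrite divr_gt0.
  have [k _ /(_ k (leqnn k)) ke] := near_infty_natSinv_lt (PosNum e20).
  have [q hq] : exists q : 'rV[rat]_d, forall i,
      `|v ord0 i - ratr (q ord0 i)| < k.+1%:R^-1.
    have ex i : exists q : rat, `|v ord0 i - ratr q| < k.+1%:R^-1.
      have /rat_in_itvoo[q] : v ord0 i - k.+1%:R^-1 < v ord0 i + k.+1%:R^-1.
        by rewrite ltrBlDr -addrA ltrDl addr_gt0.
      by rewrite in_itv /= -ltr_distlC => h; exists q.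
    have [q hq] := choice ex.
    by exists (\row_i q i) => i; rewrite mxE.
  exists (q, k) => //= w Bw; apply: eU; split=> // i j.
  rewrite (ord1 i) /ball /= -(subrKA (ratr (q ord0 j))).
  rewrite (le_lt_trans (ler_normD _ _))// (splitr e) ltrD//.
    exact: lt_trans (hq j) ke.
  by rewrite distrC; exact: lt_trans (Bw j) ke.
rewrite preimage_bigcup bigcup_mkcond.
apply: countable_bigcupT_measurable => [|p]; first exact: countableP.
case: ifPn => // _; rewrite (_ : f @^-1` B p = \bigcap_(i in [set: 'I_d])
   [set t | `|(f t : 'rV[R]_d) ord0 i - ratr (p.1 ord0 i)| < p.2.+1%:R^-1]).
  apply: fin_bigcap_measurable => // i _.
  pose q : R := ratr (p.1 ord0 i); pose r : R := p.2.+1%:R^-1.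
  rewrite (_ : [set _ | _] = (fun t => (f t : 'rV[R]_d) ord0 i) @^-1`
      `](q - r), (q + r)[%classic).
    by rewrite -[X in measurable X]setTI; exact: mf.
  by apply/seteqP; split=> t /=; rewrite in_itv /= distrC ltr_distlC.
by apply/seteqP; split=> t Bt => [i _|i]; exact: Bt.
Qed.


Definition cons_row d (p : R * Rd d) : Rd d.+1 :=
  row_mx (const_mx p.1 : 'rV[R]_1) (p.2 : 'rV[R]_d).

Lemma cons_row0 d p : (@cons_row d p : 'rV[R]_d.+1) ord0 ord0 = p.1.
Proof.
rewrite /cons_row (_ : ord0 = lshift d (ord0 : 'I_1)); last exact/val_inj.
by rewrite (row_mxEl (const_mx p.1 : 'rV[R]_1)) mxE.
Qed.

Lemma cons_rowS d p (i : 'I_d) :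
  (@cons_row d p : 'rV[R]_d.+1) ord0 (rshift 1 i) = (p.2 : 'rV[R]_d) ord0 i.
Proof. exact: (row_mxEr (const_mx p.1 : 'rV[R]_1)). Qed.

Lemma measurable_cons_row d : measurable_fun setT (@cons_row d).
Proof.
apply: measurable_rowP => i; have [j ->|j ->] := @split_ordP 1 d i.
  rewrite (_ : (fun _ => _) = fst) //; apply/funext => p.
  by rewrite (_ : lshift d j = ord0) ?cons_row0//; apply/val_inj; rewrite (ord1 j).
rewrite (_ : (fun _ => _) = (fun v : Rd d => (v : 'rV[R]_d) ord0 j) \o snd).
  by apply: measurableT_comp; [exact: measurable_coord|exact: measurable_snd].
by apply/funext => p; exact: cons_rowS.
Qed.

Definition uncons_row d (v : Rd d.+1) : R * Rd d :=
  ((v : 'rV[R]_d.+1) ord0 ord0, \row_i (v : 'rV[R]_d.+1) ord0 (rshift 1 i)).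

Lemma cons_rowK d : cancel (@cons_row d) (@uncons_row d).
Proof.
move=> [x v]; rewrite /uncons_row cons_row0; congr pair.
by apply/rowP => i; rewrite mxE cons_rowS.
Qed.

Lemma measurable_uncons_row d : measurable_fun setT (@uncons_row d).
Proof.
apply/measurable_fun_pairP; split; first exact: measurable_coord.
apply: measurable_rowP => i; under eq_fun do rewrite mxE.
exact: measurable_coord.
Qed.

Section lebesgue_step.
Variables (d : nat) (mu : {sigma_finite_measure set (Rd d) -> \bar R}).

Definition lebesgue_step : set (Rd d.+1) -> \bar R :=
  pushforward (lebesgue_measure \x mu)%E (@cons_row d).

Let step0 : lebesgue_step set0 = 0%E.
Proof. by rewrite /lebesgue_step /pushforward preimage_set0 measure0. Qed.

Let step_ge0 A : (0 <= lebesgue_step A)%E.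
Proof. by rewrite /lebesgue_step /pushforward measure_ge0. Qed.

Let step_sigma_additive : semi_sigma_additive lebesgue_step.
Proof.
have mpre A : measurable A -> measurable (@cons_row d @^-1` A).
  by move=> mA; rewrite -[X in measurable X]setTI; exact: measurable_cons_row.
move=> F mF tF mUF; rewrite /lebesgue_step /pushforward preimage_bigcup.
apply: measure_semi_sigma_additive => [n||]; first exact: mpre.
- apply/trivIsetP => i j _ _ ij; rewrite -preimage_setI.
  by move/trivIsetP : tF => /(_ _ _ _ _ ij) ->//; rewrite preimage_set0.
- by rewrite -preimage_bigcup; exact: mpre.
Qed.

HB.instance Definition _ := isMeasure.Build _ _ _ lebesgue_step
  step0 step_ge0 step_sigma_additive.

Let step_sigma_finite : sigma_finite setT lebesgue_step.
Proof.
have /sigma_finiteP[F [TF ndF Foo]] := sigma_finiteT (@lebesgue_measure R).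
have /sigma_finiteP[G [TG ndG Goo]] := sigma_finiteT mu.
exists (fun n => @uncons_row d @^-1` (F n `*` G n)).
  apply/seteqP; split=> // v _.
  have [n _ Fn] : (\bigcup_n F n) (uncons_row v).1 by rewrite -TF.
  have [k _ Gk] : (\bigcup_n G n) (uncons_row v).2 by rewrite -TG.
  exists (maxn n k) => //; split.
    by have /subsetPset := ndF _ _ (leq_maxl n k); exact.
  by have /subsetPset := ndG _ _ (leq_maxr n k); exact.
move=> n; have [mFn Fnoo] := Foo n; have [mGn Gnoo] := Goo n; split.
  rewrite -[X in measurable X]setTI; apply: measurable_uncons_row => //.
  exact: measurableX.
rewrite /lebesgue_step /pushforward -comp_preimage.
rewrite (_ : _ \o _ = id); last by apply/funext; exact: cons_rowK.
by rewrite preimage_id product_measure1E// lte_mul_pinfty// ge0_fin_numE.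
Qed.

HB.instance Definition _ := Measure_isSigmaFinite.Build _ _ _ lebesgue_step
  step_sigma_finite.

End lebesgue_step.

(* d-dimensional Lebesgue measure as the iterated product of the
   one-dimensional one; see lebesgue_rV_box for its value on boxes. *)
Fixpoint lebesgue_rV (d : nat) :
    {sigma_finite_measure set (Rd d) -> \bar R} :=
  match d with
  | 0 => \d_((0 : 'rV[R]_0) : Rd 0)
  | d'.+1 => lebesgue_step (lebesgue_rV d')
  end.

Definition box d (a b : 'I_d -> R) : set (Rd d) :=
  [set v | forall i, a i <= (v : 'rV[R]_d) ord0 i <= b i].

Lemma measurable_box d (a b : 'I_d -> R) : measurable (box a b).
Proof.
rewrite (_ : box a b = \bigcap_(i in [set: 'I_d])
    ((fun v : Rd d => (v : 'rV[R]_d) ord0 i) @^-1` `[a i, b i])).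
  apply: fin_bigcap_measurable => // i _.
  by rewrite -[X in measurable X]setTI; exact: measurable_coord.
apply/seteqP; split=> v bv => [i _|i] /=; first by rewrite in_itv /= bv.
by have := bv i I; rewrite /= in_itv.
Qed.

Lemma lebesgue_rV_box d (a b : 'I_d -> R) : (forall i, a i <= b i) ->
  lebesgue_rV d (box a b) = (\prod_(i < d) (b i - a i))%:E.
Proof.
elim: d a b => [|d IH] a b ab.
  by rewrite /= big_ord0 diracE mem_set// => -[].
rewrite /= /lebesgue_step /pushforward.
rewrite (_ : _ @^-1` _ = `[a ord0, b ord0]%classic `*`
    box (fun i => a (rshift 1 i)) (fun i => b (rshift 1 i))).
  rewrite product_measure1E//; last exact: measurable_box.
  have leb0 : @lebesgue_measure R `[a ord0, b ord0]%classic =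
      (b ord0 - a ord0)%:E.
    rewrite lebesgue_measure_itv /= lte_fin; case: ltP => // ba.
    by rewrite (@le_anti _ _ (a ord0) (b ord0)) ?subrr// ab ba.
  rewrite [X in (X * _)%E]leb0 IH// -EFinM big_ord_recl; congr (_ * _)%:E.
  apply: eq_bigr => i _.
  by rewrite (_ : rshift 1 i = lift ord0 i)//; exact/val_inj.
apply/seteqP; split=> [[x v] /= h|[x v] /= [h0 hS] i].
  split=> [|i] /=; first by have := h ord0; rewrite cons_row0 in_itv.
  by have := h (rshift 1 i); rewrite cons_rowS.
have [j ->|j ->] := @split_ordP 1 d i; last by rewrite cons_rowS; exact: hS.
rewrite (_ : lshift d j = ord0); last by apply/val_inj; rewrite (ord1 j).
by rewrite cons_row0; move: h0; rewrite in_itv.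
Qed.

End euclidean_space.

Section weak_topology.
Variables (R : realType) (d : nat).

Record bounded_continuous := BoundedContinuous {
  bc_fun :> Rd R d -> R ;
  _ : continuous (bc_fun : 'rV[R]_d -> R) ;
  _ : exists M : R, forall x, `|bc_fun x| <= M }.

(* The weak topology on probability measures is the initial topology of the maps
   m |-> \int f dm, f bounded and continuous. *)
Definition expectations (m : probability (Rd R d) R) :
  {ptws bounded_continuous -> R} := fun f => \int[m]_x f x.

Definition weakly_continuous (G : probability (Rd R d) R -> R) :=
  continuous (G : initial_topology expectations -> R).

End weak_topology.

Section mixture.
Variables (d : measure_display) (T : measurableType d) (R : realType).

(* The mixture m + l (m' - m) is a probability measure for l in [0, 1] only;
   outside [0, 1] the coefficient is clipped, so that mixture l m m' is one for
   every l. *)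
Definition clip01 (l : R) : R := Num.max 0 (Num.min l 1).

Lemma clip01_ge0 l : 0 <= clip01 l.
Proof. by rewrite le_max lexx. Qed.

Lemma clip01_le1 l : clip01 l <= 1.
Proof. by rewrite ge_max ler01 ge_min lexx orbT. Qed.

Lemma onem_clip01_ge0 l : 0 <= 1 - clip01 l.
Proof. by rewrite subr_ge0 clip01_le1. Qed.

Definition mixture (l : R) (m m' : probability T R) : set T -> \bar R :=
  measure_add (mscale (NngNum (onem_clip01_ge0 l)) m)
              (mscale (NngNum (clip01_ge0 l)) m').

Variables (l : R) (m m' : probability T R).

HB.instance Definition _ := Measure.on (mixture l m m').

Let mixture_setT : mixture l m m' setT = 1%E.
Proof.
rewrite /mixture measure_addE /mscale.
transitivity ((1 - clip01 l)%:E * 1 + (clip01 l)%:E * 1)%E.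
  by congr (_ * _ + _ * _)%E; exact: probability_setT.
by rewrite !mule1 -EFinD subrK.
Qed.

HB.instance Definition _ :=
  Measure_isProbability.Build _ _ _ (mixture l m m') mixture_setT.

End mixture.

Section density.
Variables (R : realType) (d : nat).

(* A density is a function defined at every point (not a class of functions up
   to almost everywhere equality): ratios and the evolution equation are
   evaluated at every x. *)
Record density := Density {
  pdf :> Rd R d -> R ;
  measurable_pdf : measurable_fun setT pdf ;
  pdf_ge0 : forall x, 0 <= pdf x ;
  integral_pdf : (\int[lebesgue_rV R d]_x (pdf x)%:E = 1)%E }.

Definition density_prob (m : density) : set (Rd R d) -> \bar R :=
  fun A => (\int[lebesgue_rV R d]_(x in A) (m x)%:E)%E.

Variable m : density.

Let density_prob0 : density_prob m set0 = 0%E.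
Proof. by rewrite /density_prob integral_set0. Qed.

Let density_prob_ge0 A : (0 <= density_prob m A)%E.
Proof. by apply: integral_ge0 => x _; rewrite lee_fin pdf_ge0. Qed.

Let density_prob_sigma_additive : semi_sigma_additive (density_prob m).
Proof.
apply: semi_sigma_additive_nng_induced => [|x]; last by rewrite lee_fin pdf_ge0.
by apply/measurable_EFinP; exact: measurable_pdf.
Qed.

HB.instance Definition _ := isMeasure.Build _ _ _ (density_prob m)
  density_prob0 density_prob_ge0 density_prob_sigma_additive.

HB.instance Definition _ := Measure_isProbability.Build _ _ _ (density_prob m)
  (integral_pdf m).

End density.

Section birth_death.
Variables (R : realType) (d : nat).
Local Notation P := (probability (Rd R d) R).

(* The integral of f against the signed measure m' - m. *)
Definition diff_integral (m' m : P) (f : Rd R d -> R) : \bar R :=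
  (\int[m']_x (f x)%:E - \int[m]_x (f x)%:E)%E.

(* Normalized flat derivative. Measurability of dG m is what gives the integrals
   a meaning; since the right-hand side of the fourth condition is equal to a
   real number, the integral over l is then finite too. *)
Definition flat_derivative (G : P -> R) (dG : P -> Rd R d -> R) :=
  [/\ forall a, weakly_continuous (dG ^~ a),
      forall m, measurable_fun setT (dG m),
      forall m, exists M : R, forall a, `|dG m a| <= M,
      forall m m' : P, ((G m' - G m)%:E =
        \int[lebesgue_measure]_(l in `[0%R, 1%R])
          diff_integral m' m (dG (mixture l m m')))%E &
      forall m : P, (\int[m]_x (dG m x)%:E = 0)%E].

(* For each a, the flat derivative of m |-> dF m a is m, a' |-> d2F m a' a. *)
Definition flat_derivative2 (dF : P -> Rd R d -> R)
    (d2F : P -> Rd R d -> Rd R d -> R) :=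
  forall a, flat_derivative (dF ^~ a) (fun m a' => d2F m a' a).

Definition flat_convex (F : P -> R) (dF : P -> Rd R d -> R) :=
  forall m m' : P, ((F m - F m')%:E <= diff_integral m m' (dF m))%E.

(* Relative entropy of the probability measures with densities m and pi. Since
   ln 0 = 0, the integrand vanishes where m does. *)
Definition KL (m pi : density R d) : \bar R :=
  if `[< density_prob m `<< density_prob pi >] then
    (\int[lebesgue_rV R d]_x (ln (m x / pi x) * m x)%:E)%E
  else +oo%E.

(* For D = [0, +oo[ this is the usual derivative at t > 0 and the right
   derivative at t = 0. *)
Definition has_derivative_within (D : set R) (f : R -> R) (t v : R) :=
  (fun s => (f s - f t) / (s - t)) @ within D t^' --> v.

Definition birth_death_solution (sigma : R) (dF : P -> Rd R d -> R)
    (pi m0 : density R d) (m : R -> density R d) :=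
  [/\ forall x, m 0 x = m0 x,
      forall t, 0 <= t -> (KL (m t) pi < +oo)%E &
      forall t x, 0 <= t ->
        has_derivative_within [set s | 0 <= s] (fun s => m s x) t
          (- (dF (density_prob (m t)) x + sigma ^+ 2 / 2 * ln (m t x / pi x)
              - sigma ^+ 2 / 2 * fine (KL (m t) pi)) * m t x)].

End birth_death.

(* Main.v *)
Require Import Defs.
From mathcomp Require Import all_boot all_order all_algebra.
From mathcomp Require Import all_classical all_reals all_analysis.
From mathcomp Require Import measurable_realfun.
From mathcomp Require Import ring lra.

Set Implicit Arguments.
Unset Strict Implicit.
Unset Printing Implicit Defensive.

Import Order.TTheory GRing.Theory Num.Theory.
Import numFieldNormedType.Exports.

Local Open Scope classical_set_scope.
Local Open Scope ring_scope.

(** Write [c = sigma^2/2], [a_t = dF (m_t)] and [g = m0 / pi]. For each [x] the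
    equation says that [ln (m_t x / pi x)] solves a linear equation with the
    bounded forcing [a_t x], up to the term [c * KL (m_t | pi)]. That term does
    not depend on [x]: it only keeps the total mass equal to 1. Everything below
    consists in working modulo functions of time.

    Existence. Put [m_t = u_t * pi / Z_t] with [Z_t] the integral of [u_t * pi],
    and require [u' = - u * (a + c * ln u)], the equation without entropy
    ([is_derive_weight]). It is solved by [u_t = g ^ exp (-ct) * exp z_t], where
    [z' = - a - c z] and [z_0 = 0], so that [|z| <= C / c]. The normalization
    of [dF] gives [Z' / Z = - c * (integral of ln u dm)], which is exactly what
    restores the entropy term ([partition_derive]). There remains a
    fixed point problem, since [a] depends on [z] through [m]: a bounded second
    flat derivative makes [dF] Lipschitz in total variation
    ([flat_derivative_tv_lipschitz]), the density [m_t] is Lipschitz in [z_t]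
    in total variation ([gibbs_tv]), and Picard iteration converges in a norm
    weighted by an exponential of time ([picard]).

    Bounds. As [0 <= g <= R] with [R >= 1] and [0 < exp (-ct) <= 1], we have
    [g / R <= g ^ exp (-ct) <= R], hence [u <= R * exp (C/c)] and
    [Z >= exp (-C/c) / R]. So [m_t / pi <= M] with [M = R^2 * exp (2C/c)], and
    the entropy is at most [ln M = 2 ln R + 4C / sigma^2]. The lower bound
    on [m_t / pi] is obtained in the same way.

    Uniqueness. Nothing is known about [t |-> KL (m_t | pi)] for an arbitrary
    solution, not even local boundedness, but the entropy disappears from
    ratios [m_t x / m_t y]. Such a ratio solves [q' = q * (b + k * ln q)] with
    [b] bounded, so it cannot reach or leave 0 ([log_ode_gt0]), and a solution
    vanishes exactly where [m0] does ([flow_pos]). For two solutions [m], [m'],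
    the differences of [D_t x = ln (m_t x) - ln (m'_t x)] between
    two points solve a linear equation whose forcing is controlled by the total
    variation distance of [m_t] and [m'_t]. Conversely, because both have mass 1,
    a bound on the oscillation of [D_t] bounds [D_t] itself and that distance
    ([log_ratio_norm_le], [log_ratio_tv_le]). The weighted estimate used for
    Picard iteration then forces [D = 0] ([flow_unique]). *)

(** * Integrals, densities and total variation *)

Section measure.
Context {disp : measure_display} {T : measurableType disp} {R : realType}.
Variable mu : {measure set T -> \bar R}.

(** The integral of a nonnegative function is a supremum over the simple
    functions below it, so it is monotone without any measurability. This matters
    for the integral over the mixing parameter of a flat derivative, whose
    integrand is not assumed to be measurable. *)
Lemma ge0_le_integral_nonmeasurable (D : set T) (f g : T -> \bar R) :
  (forall x, D x -> 0 <= f x)%E -> (forall x, D x -> f x <= g x)%E ->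
  (\int[mu]_(x in D) f x <= \int[mu]_(x in D) g x)%E.
Proof.
move=> f0 fg; have g0 x : D x -> (0 <= g x)%E.
  by move=> Dx; exact: le_trans (f0 x Dx) (fg x Dx).
rewrite !ge0_integralE//; apply: ereal_sup_le => _ [h hf <-].
exists h => // x; apply: le_trans (hf x) _; rewrite !patchE.
by case: ifPn => // /set_mem; exact: fg.
Qed.

Lemma abse_integral_le_nonmeasurable (D : set T) (f : T -> \bar R) (K : R) :
  measurable D -> (mu D <= 1)%E -> 0 <= K -> (forall x, D x -> `|f x| <= K%:E)%E ->
  (`| \int[mu]_(x in D) f x| <= K%:E)%E.
Proof.
move=> mD D1 K0 fK.
have KI (g : T -> \bar R) : (forall x, D x -> 0 <= g x <= K%:E)%E ->
    (0 <= \int[mu]_(x in D) g x <= K%:E)%E.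
  move=> gK; apply/andP; split.
    by apply: integral_ge0 => x /gK /andP[].
  apply: (@le_trans _ _ (\int[mu]_(x in D) (cst K%:E) x)%E).
    by apply: ge0_le_integral_nonmeasurable => x /gK /andP[].
  by rewrite integral_cst//= -[leRHS]mule1 lee_wpmul2l.
have /andP[p0 pK] : (0 <= \int[mu]_(x in D) f^\+ x <= K%:E)%E.
  apply: KI => x Dx; rewrite funepos_ge0 /= unlock ge_max lee_fin K0 andbT.
  exact: le_trans (lee_abs _) (fK _ Dx).
have /andP[n0 nK] : (0 <= \int[mu]_(x in D) f^\- x <= K%:E)%E.
  apply: KI => x Dx; rewrite funeneg_ge0 /= unlock ge_max lee_fin K0 andbT.
  by rewrite (le_trans (lee_abs _))// abseN fK.
rewrite integralE.
have fp : (\int[mu]_(x in D) f^\+ x)%E \is a fin_num.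
  by rewrite ge0_fin_numE// (le_lt_trans pK)// ltry.
have fn : (\int[mu]_(x in D) f^\- x)%E \is a fin_num.
  by rewrite ge0_fin_numE// (le_lt_trans nK)// ltry.
move: p0 pK n0 nK; rewrite -(fineK fp) -(fineK fn) -EFinB abse_EFin !lee_fin.
move=> p0 pK n0 nK; rewrite ler_norml; lra.
Qed.

Lemma integrable_EFinZ (f : T -> R) (k : R) :
  mu.-integrable setT (EFin \o f) ->
  mu.-integrable setT (EFin \o (fun x => k * f x)).
Proof. by move=> fi; apply: (integrableZl _ k fi). Qed.

Lemma integrable_EFinD (f g : T -> R) :
  mu.-integrable setT (EFin \o f) -> mu.-integrable setT (EFin \o g) ->
  mu.-integrable setT (EFin \o (fun x => f x + g x)).
Proof. by move=> fi gi; apply: (integrableD _ fi gi). Qed.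

Lemma integrable_EFinB (f g : T -> R) :
  mu.-integrable setT (EFin \o f) -> mu.-integrable setT (EFin \o g) ->
  mu.-integrable setT (EFin \o (fun x => f x - g x)).
Proof. by move=> fi gi; apply: (integrableB _ fi gi). Qed.

End measure.

Section density_lemmas.
Variables (R : realType) (d : nat).
Local Notation mu := (lebesgue_rV R d).
Local Notation P := (probability (Rd R d) R).

Lemma integrable_pdf (m : density R d) :
  mu.-integrable setT (EFin \o m).
Proof.
apply/integrableP; split; first by apply/measurable_EFinP; exact: measurable_pdf.
under eq_integral do rewrite /= ger0_norm ?pdf_ge0//.
by rewrite integral_pdf ltry.
Qed.

Lemma Rintegral_pdf (m : density R d) : \int[mu]_x m x = 1.
Proof. by rewrite /Rintegral integral_pdf. Qed.

Lemma integrable_le_pdf (m : density R d) (f : Rd R d -> R) (K : R) :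
  measurable_fun setT f -> (forall x, `|f x| <= K * m x) ->
  mu.-integrable setT (EFin \o f).
Proof.
move=> mf fK; apply: le_integrable (integrable_EFinZ K (integrable_pdf m)) => //.
  exact/measurable_EFinP.
by move=> x _; rewrite /= lee_fin (le_trans (fK x))// ler_norm.
Qed.

Lemma density_prob_dominates (m : density R d) :
  density_prob m `<< (mu : set _ -> \bar R).
Proof.
apply/null_content_dominatesP => A mA A0; rewrite /density_prob.
apply: null_set_integral => //.
by apply: measurable_funTS; apply/measurable_EFinP; exact: measurable_pdf.
Qed.

(** A density is a version of the Radon-Nikodym derivative of its measure. *)
Lemma integral_density_prob (m : density R d) (f : Rd R d -> R) (K : R) :
  measurable_fun setT f -> (forall x, `|f x| <= K) ->
  (\int[density_prob m]_x (f x)%:E = \int[mu]_x (f x * m x)%:E)%E.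
Proof.
move=> mf fK.
have fi : (density_prob m).-integrable setT (EFin \o f).
  apply: measurable_bounded_integrable => //.
    by rewrite -ge0_fin_numE ?fin_num_measure.
  exists K; split; first exact: num_real.
  by move=> M KM x _; exact: le_trans (fK x) (ltW KM).
have mm := @measurable_pdf _ _ m.
rewrite -(Radon_Nikodym_change_of_variables (density_prob_dominates m))//=.
under [RHS]eq_integral do rewrite EFinM.
apply: ae_eq_integral => //.
- apply: emeasurable_funM => //; first exact/measurable_EFinP.
  apply: measurable_int.
  by apply: Radon_Nikodym_integrable; exact: density_prob_dominates.
- by apply: emeasurable_funM => //; exact/measurable_EFinP.
- apply: ae_eqe_mul2l => /=.
  rewrite Radon_NikodymE//=; first exact: density_prob_dominates.
  move=> dom; case: cid => /= h [h1 h2 h3].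
  apply: integral_ae_eq => //=; first exact/measurable_EFinP.
  by move=> E _ mE; rewrite -h3.
Qed.

Lemma integrable_dist_pdf (m m' : density R d) :
  mu.-integrable setT (EFin \o (fun x => `|m' x - m x|)).
Proof.
apply: (integrable_norm (f := fun x => m' x - m x)).
by apply: integrable_EFinB; exact: integrable_pdf.
Qed.

Lemma diff_integral_le (m m' : density R d) (f : Rd R d -> R) (K : R) :
  measurable_fun setT f -> (forall x, `|f x| <= K) ->
  (`|diff_integral (density_prob m') (density_prob m) f|
    <= (K * \int[mu]_x `|m' x - m x|)%:E)%E.
Proof.
move=> mf fK; rewrite /diff_integral !(integral_density_prob _ mf fK).
have fmi (p : density R d) : mu.-integrable setT (EFin \o (fun x => f x * p x)).
  apply: (@integrable_le_pdf p _ K).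
    by apply: measurable_funM => //; exact: measurable_pdf.
  by move=> x; rewrite normrM (ger0_norm (pdf_ge0 _ _)) ler_wpM2r ?pdf_ge0.
rewrite -integralB_EFin//.
under eq_integral do rewrite -EFinB -mulrBr.
have mB : measurable_fun setT (fun x => f x * (m' x - m x)).
  by apply: measurable_funM => //; apply: measurable_funB; exact: measurable_pdf.
apply: (le_trans (le_abse_integral _ _ _)) => //; first exact/measurable_EFinP.
have K0 : 0 <= K by exact: le_trans (fK 0).
apply: (@le_trans _ _ (\int[mu]_x (K%:E * `|m' x - m x|%:E))%E).
  apply: ge0_le_integral_nonmeasurable => [x _|x _]; first by [].
  by rewrite /= lee_fin normrM ler_wpM2r.
rewrite integralZl//; last exact: integrable_dist_pdf.
rewrite EFinM /Rintegral fineK//; apply: integrable_fin_num => //.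
exact: integrable_dist_pdf.
Qed.

(** The mixing parameter ranges over an interval of length 1, and for each of its
    values the integral against [m' - m] is at most [K] times the mass of
    [|m' - m|]. *)
Lemma flat_derivative_tv_lipschitz (G : P -> R) (dG : P -> Rd R d -> R) (K : R) :
  flat_derivative G dG -> (forall m x, `|dG m x| <= K) ->
  forall m m' : density R d,
  `|G (density_prob m') - G (density_prob m)| <= K * \int[mu]_x `|m' x - m x|.
Proof.
move=> [_ mdG _ GE _] dGK m m'.
have K0 : 0 <= K by exact: le_trans (dGK (density_prob m) 0).
rewrite -lee_fin -abse_EFin GE; apply: abse_integral_le_nonmeasurable => //.
- have := @lebesgue_measure_itv R `[0, 1]%R.
  by rewrite /= lte_fin ltr01 oppr0 adde0 => ->.
- by rewrite mulr_ge0// Rintegral_ge0.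
- by move=> l _; apply: diff_integral_le.
Qed.

End density_lemmas.

(** * Scalar differential equations *)

Section real_analysis.
Variable R : realType.
Implicit Types (f df y b : R -> R) (c t s : R).

Lemma is_derive_expRM c t :
  is_derive t 1 (fun s => expR (c * s)) (c * expR (c * t)).
Proof.
have h : is_derive t 1 (fun s : R => c * s) c.
  apply: (is_derive_eq (is_deriveZ (f := id) c (is_derive_id t 1))).
  by rewrite /GRing.scale /= mulr1.
apply: (is_derive_eq (@is_derive1_comp _ expR (fun s => c * s) t _ _ _ h)).
by rewrite mulrC.
Qed.

Lemma is_derive_continuous f t a : is_derive t 1 f a -> {for t, continuous f}.
Proof.
by move=> [df _]; apply: differentiable_continuous; apply/derivable1_diffP.
Qed.

Lemma continuous_expRM c : continuous (fun s : R => expR (c * s)).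
Proof. by move=> s; apply: is_derive_continuous; exact: is_derive_expRM. Qed.

Lemma mean_value_le f df (a b K : R) : a <= b ->
  (forall x, a < x < b -> is_derive x 1 f (df x)) ->
  {within `[a, b], continuous f} ->
  (forall x, a < x < b -> `|df x| <= K) -> `|f b - f a| <= K * (b - a).
Proof.
rewrite le_eqVlt => /predU1P[-> *|ab fdf fc dfK].
  by rewrite !subrr normr0 mulr0.
have [x] := @MVT _ f df a b ab (fun x => fdf x) fc.
rewrite in_itv /= => xab ->.
by rewrite normrM (gtr0_norm (x := b - a)) ?subr_gt0// ler_pM2r ?subr_gt0 ?dfK.
Qed.

(** Compare [expR (c * t) * y t] with the primitive
    [A / (lam + c) * expR ((lam + c) * t)]. The factor [(lam + c)^-1], small for
    large [lam], is what makes the time-weighted norms contract. *)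
Lemma linear_ode_le c lam A y b : 0 < lam + c -> 0 <= A ->
  {within `[0, +oo[, continuous y} -> y 0 = 0 ->
  (forall t, 0 < t -> is_derive t 1 y (- b t - c * y t)) ->
  (forall t, 0 < t -> `|b t| <= A * expR (lam * t)) ->
  forall t, 0 <= t -> `|y t| <= A * expR (lam * t) / (lam + c).
Proof.
move=> lc0 A0.
have half (z e : R -> R) : {within `[0, +oo[, continuous z} -> z 0 = 0 ->
  (forall t, 0 < t -> is_derive t 1 z (- e t - c * z t)) ->
  (forall t, 0 < t -> `|e t| <= A * expR (lam * t)) ->
  forall t, 0 <= t -> z t <= A * expR (lam * t) / (lam + c).
  move=> zc z0 dz eA t t0.
  pose g s := A / (lam + c) * expR ((lam + c) * s) - expR (c * s) * z s.
  have dg s : 0 < s -> is_derive s 1 g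
      (A * expR ((lam + c) * s) + expR (c * s) * e s).
    move=> s0.
    have d1 := is_derive_expRM (lam + c) s.
    have d2 := is_derive_expRM c s.
    have d3 := dz s s0.
    apply: (is_derive_eq (is_deriveB (is_deriveZ (A / (lam + c)) d1)
      (is_deriveM d2 d3))).
    rewrite /GRing.scale /=; field.
    by rewrite gt_eqF.
  have g0t : g 0 <= g t.
    apply: (@ger0_derive1_ndecry _ g 0 _ _ _ 0 t (lexx 0) t0).
    - by move=> s; rewrite in_itv /= andbT => /dg[].
    - move=> s; rewrite in_itv /= andbT => s0.
      rewrite derive1E (@derive_val _ _ _ _ _ _ _ (dg s s0)).
      have := eA s s0; rewrite ler_norml => /andP[h _].
      rewrite mulrDl expRD (mulrC (expR (lam * s))) mulrCA -mulrDr.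
      by rewrite mulr_ge0 ?expR_ge0// -lerBlDl sub0r.
    - apply/subspace_continuousP => s s0.
      have expc k : expR (k * u) @[u --> within `[0, +oo[ (nbhs s)] --> expR (k * s).
        by apply: cvg_within_filter; exact: continuous_expRM.
      apply: cvgB; first by apply: cvgM => //; exact: cvg_cst.
      by apply: cvgM => //; move/subspace_continuousP : zc; exact.
  move: g0t; rewrite /g z0 !mulr0 subr0 expR0 mulr1.
  have h0 : 0 <= A / (lam + c) by rewrite divr_ge0// ltW.
  move=> /(le_trans h0); rewrite subr_ge0 mulrDl expRD mulrA (mulrC (expR (c * t))).
  by rewrite ler_pM2r ?expR_gt0// mulrAC.
move=> yc y0 dy bA t t0; rewrite ler_norml; apply/andP; split; last first.
  exact: half yc y0 dy bA t t0.
rewrite lerNl; apply: (half (fun s => - y s) (fun s => - b s)) => //.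
- apply/subspace_continuousP => s s0; apply: cvgN.
  by move/subspace_continuousP : yc; exact.
- by rewrite y0 oppr0.
- move=> s s0; have ds := dy s s0.
  by apply: (is_derive_eq (is_deriveN ds)); ring.
- by move=> s s0; rewrite normrN bA.
Qed.

Lemma first_zero f (T : R) : 0 <= T -> {within `[0, T], continuous f} ->
  (forall t, 0 <= t <= T -> 0 <= f t) ->
  0 < f 0 -> f T = 0 ->
  exists r, [/\ 0 < r <= T, f r = 0 & forall t, 0 <= t < r -> 0 < f t].
Proof.
move=> T0 /subspace_continuousP fc f0 f00 fT0.
pose Z := [set t | 0 <= t <= T /\ f t = 0].
have ZT : Z T by split; rewrite ?T0 ?lexx.
have hinf : has_inf Z by split; [exists T|exists 0 => t [/andP[]]].
pose r := inf Z.
have rZ t : Z t -> r <= t by move=> Zt; apply: ge_inf => //; case: hinf.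
have r0 : 0 <= r by apply: lb_le_inf; [exists T|move=> t [/andP[]]].
have rT : r <= T by exact: rZ.
have pos t : 0 <= t < r -> 0 < f t.
  move=> /andP[t0 tr].
  have tT : t <= T by apply: ltW; exact: lt_le_trans tr rT.
  rewrite lt0r f0 ?t0 ?tT// andbT; apply/eqP => ft0.
  have : r <= t by apply: rZ; split; rewrite ?t0 ?tT.
  by rewrite leNgt tr.
have fr : f r = 0.
  apply/eqP; apply: contraT => fr0.
  have fr_gt0 : 0 < f r by rewrite lt0r fr0 f0 // r0 rT.
  have rT' : `[0, T]%classic r by rewrite /= in_itv /= r0 rT.
  have /nbhs_ballP[e /= e0 He] : \forall t \near r, `[0, T]%classic t -> 0 < f t.
    exact: (@cvgr_gt _ _ _ (within_filter _ _) _ (f r) (fc r rT') _ fr_gt0).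
  have [z [/andP[z0 zT] fz] zre] := inf_adherent e0 hinf.
  have rz : r <= z by apply: rZ; split; rewrite ?z0 ?zT.
  have : 0 < f z.
    apply: He; last by rewrite /= in_itv /= z0 zT.
    by rewrite /ball /= distrC ger0_norm ?subr_ge0// ltrBlDl.
  by rewrite fz ltxx.
exists r; split => //; rewrite rT andbT lt0r r0 andbT; apply/eqP => r00.
by move: fr; rewrite r00 => /eqP; rewrite gt_eqF.
Qed.

(** While [q > 0], its logarithm solves a linear equation with bounded forcing,
    hence stays bounded on bounded time intervals. So [q] is bounded away from 0
    up to its first zero, and there is none. *)
Lemma log_ode_gt0 (q b : R -> R) (k B T : R) : 0 <= T ->
  {within `[0, T], continuous q} -> (forall t, 0 <= t <= T -> 0 <= q t) ->
  (forall t, 0 < t < T -> 0 < q t -> is_derive t 1 q (q t * (b t + k * ln (q t)))) ->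
  (forall t, 0 < t < T -> `|b t| <= B) -> 0 < q 0 -> 0 < q T.
Proof.
move=> T0 qc q0 dq bB q00; rewrite lt0r q0 ?T0 ?lexx// andbT; apply/eqP => qT0.
have [r [/andP[r0 rT] qr qpos]] := first_zero T0 qc q0 q00 qT0.
pose w s := expR (- k * s) * ln (q s).
have dw s : 0 < s < r -> is_derive s 1 w (expR (- k * s) * b s).
  move=> /andP[s0 sr]; have qs : 0 < q s by rewrite qpos ?(ltW s0) ?sr.
  have d1 := is_derive_expRM (- k) s.
  have d2 := dq s _ qs; rewrite s0 (lt_le_trans sr rT) in d2.
  have d4 := is_derive1_comp (is_derive1_ln qs) (d2 isT).
  apply: (is_derive_eq (is_deriveM d1 d4)).
  rewrite /GRing.scale /=; field.
  by rewrite gt_eqF.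
have B0 : 0 <= B.
  have rT2 : 0 < r / 2 < T by rewrite divr_gt0//=; lra.
  exact: le_trans (bB _ rT2).
pose K := expR (`|k| * T) * B.
have wcont s : 0 <= s < r -> {within `[0, s], continuous w}.
  move=> /andP[s0 sr]; have qcs : {within `[0, s], continuous q}.
    apply: continuous_subspaceW qc; apply: subset_itvl; rewrite bnd_simp.
    exact: le_trans (ltW sr) rT.
  apply/subspace_continuousP => u us; apply: cvgM.
    by apply: cvg_within_filter; exact: continuous_expRM.
  apply: (@cvg_comp _ _ _ q (@ln R)).
    by move/subspace_continuousP : qcs; apply.
  apply: continuous_ln; apply: qpos.
  by move: us; rewrite /= in_itv /= => /andP[-> us]; exact: le_lt_trans us sr.
have wK s : 0 <= s < r -> w 0 - K * T <= w s.
  move=> /andP[s0 sr]; have sT : s <= T by exact: le_trans (ltW sr) rT.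
  have : `|w s - w 0| <= K * (s - 0).
    apply: (@mean_value_le w (fun s => expR (- k * s) * b s)) => //.
    - by move=> x /andP[x0 xs]; apply: dw; rewrite x0 (lt_trans xs sr).
    - by apply: wcont; rewrite s0 sr.
    - move=> x /andP[x0 xs]; rewrite normrM ger0_norm ?expR_ge0// ler_pM//.
        rewrite ler_expR (le_trans (ler_norm _))// normrM normrN ler_wpM2l//.
        by rewrite gtr0_norm// (le_trans (ltW xs)).
      by apply: bB; rewrite x0 (lt_le_trans xs).
  have : K * (s - 0) <= K * T.
    by rewrite subr0 ler_wpM2l// mulr_ge0 ?expR_ge0.
  by rewrite ler_norml => h /andP[h' _]; lra.
(* [expR L] is a lower bound for [q] before [r]; the minimum with 0 is for the
   times at which [ln (q s)] is nonnegative. *)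
pose L := Num.min 0 (expR (`|k| * T) * (w 0 - K * T)).
have lnL s : 0 <= s < r -> expR L <= q s.
  move=> sr; have := wK s sr; rewrite /w => h.
  have qs := qpos s sr; rewrite -[leRHS](lnK qs) ler_expR /L ge_min.
  case: (leP 0 (ln (q s))) => //= lq0.
  move/andP : sr => [s0 sr]; apply: le_trans (_ : expR (k * s) * (w 0 - K * T) <= _).
    rewrite ler_wnM2r//.
      by rewrite (le_trans h)// pmulr_rle0 ?expR_gt0// ltW.
    rewrite ler_expR (le_trans (ler_norm _))// normrM ler_wpM2l//.
    by rewrite ger0_norm// (le_trans (ltW sr) rT).
  rewrite -(ler_pM2l (expR_gt0 (- k * s))) mulrA -expRD.
  by rewrite (_ : - k * s + k * s = 0) ?expR0 ?mul1r//; ring.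
have /subspace_continuousP qcP := qc.
have rin : `[0, T]%classic r by rewrite /= in_itv /= (ltW r0) rT.
have /nbhs_ballP[e /= e0 He] :
    \forall t \near r, `[0, T]%classic t -> q t < expR L.
  apply: (@cvgr_lt _ _ _ (within_filter _ _) _ (q r) (qcP r rin)).
  by rewrite qr expR_gt0.
pose s := Num.max 0 (r - e / 2).
have sr : 0 <= s < r.
  rewrite /s le_max lexx /= gt_max r0 /= ltrBlDr ltrDl; lra.
have /andP[s0 sr'] := sr.
have : q s < expR L.
  apply: He; last by rewrite /= in_itv /= s0 (ltW (lt_le_trans sr' rT)).
  rewrite /ball /= gtr0_norm ?subr_gt0// ltrBlDl -ltrBlDr /s lt_max.
  by rewrite [X in _ || X](_ : _ = true) ?orbT//; lra.
by rewrite ltNge lnL.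
Qed.

End real_analysis.

(** * Time integrals depending on a parameter *)

Section geometric_sequences.
Variable R : realType.
Implicit Types (u : nat -> R) (M a : R).

Lemma cvg_half_geometric M : M * 2^-1 ^+ n @[n --> \oo] --> 0.
Proof.
apply: (@cvg_geometric R M 2^-1).
by rewrite ger0_norm ?invr_ge0// invf_lt1// ltr1n.
Qed.

Lemma half_geometric_eq0 a M : (forall n : nat, `|a| <= M * 2^-1 ^+ n) -> a = 0.
Proof.
move=> aM; apply/eqP; rewrite -normr_le0.
apply: (@cvgr_to_ge _ _ _ _ _ _ _ (cvg_half_geometric M)).
exact: nearW.
Qed.

(** Completeness, with the rate of convergence. *)
Lemma half_geometric_cvg u M :
  (forall n, `|u n.+1 - u n| <= M * 2^-1 ^+ n) ->
  cvgn u /\ forall n, `|limn u - u n| <= 2 * M * 2^-1 ^+ n.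
Proof.
move=> uM.
have M0 : 0 <= M by have := le_trans (normr_ge0 _) (uM 0%N); rewrite expr0 mulr1.
have uk n k : `|u (n + k)%N - u n| <= 2 * M * 2^-1 ^+ n * (1 - 2^-1 ^+ k).
  elim: k => [|k ih]; first by rewrite addn0 !subrr normr0 mulr0.
  rewrite -(subrKA (u (n + k)%N)) (le_trans (ler_normD _ _))//.
  apply: (le_trans (lerD _ ih)); first by rewrite addnS; exact: uM.
  by rewrite exprD exprS; lra.
have uk' n k : `|u (n + k)%N - u n| <= 2 * M * 2^-1 ^+ n.
  apply: (le_trans (uk n k)); rewrite ler_piMr//.
  by rewrite !mulr_ge0// exprn_ge0// invr_ge0.
have uc : cvgn u.
  apply: cauchy_cvg; apply: cauchy_exP => e e0.
  have [N _ HN] : \forall n \near \oo, 2 * M * 2^-1 ^+ n < e.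
    by apply: (cvgr_lt 0) => //; exact: cvg_half_geometric.
  exists (u N); exists N => // n /= Nn.
  rewrite /ball /= distrC -(subnKC Nn); apply: le_lt_trans (uk' N _) (HN N _).
  by rewrite /=.
split => // n.
have ucn : u k - u n @[k --> \oo] --> limn u - u n.
  by apply: cvgB; [exact: uc|exact: cvg_cst].
apply: (cvgr_to_le (cvg_norm ucn)).
by exists n => // k /= nk; rewrite -(subnKC nk).
Qed.

End geometric_sequences.

Section primitive.
Variable R : realType.
Implicit Types (h f : R -> R) (c t : R).

(** The base point -1 makes 0 an interior point, so that the derivative at the
    initial time is two-sided. *)
Definition primitive h t : R :=
  \int[lebesgue_measure]_(s in `[-1, t]) h s -
  \int[lebesgue_measure]_(s in `[-1, 0]) h s.

Lemma primitive0 h : primitive h 0 = 0.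
Proof. exact: subrr. Qed.

Lemma is_derive_primitive h t : continuous h -> -1 < t ->
  is_derive t 1 (primitive h) (h t).
Proof.
move=> hc t1.
have hi : lebesgue_measure.-integrable `[-1, t + 1] (EFin \o h).
  apply: continuous_compact_integrable; first exact: segment_compact.
  exact: continuous_subspaceT.
have [d1 d2] := continuous_FTC1_closed (ltr_pwDr ltr01 (lexx t)) hi t1 (hc t).
have d : is_derive t 1 (fun x => \int[lebesgue_measure]_(s in `[-1, x]) h s) (h t).
  by split; [exact: d1|rewrite -derive1E d2].
apply: (is_derive_eq (is_deriveB d (is_derive_cst _ _ _))).
by rewrite subr0.
Qed.

(** Variation of constants for [y' = - f - c y], [y 0 = 0]. *)
Definition linear_ode_sol c f t : R :=
  - (expR (- c * t) * primitive (fun s => expR (c * s) * f s) t).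

Lemma linear_ode_sol0 c f : linear_ode_sol c f 0 = 0.
Proof. by rewrite /linear_ode_sol primitive0 mulr0 oppr0. Qed.

Lemma is_derive_linear_ode_sol c f t : continuous f -> -1 < t ->
  is_derive t 1 (linear_ode_sol c f) (- f t - c * linear_ode_sol c f t).
Proof.
move=> fc t1.
have hc : continuous (fun s => expR (c * s) * f s).
  by move=> s; apply: cvgM; [exact: continuous_expRM|exact: fc].
have d1 := is_derive_expRM (- c) t.
have d2 := is_derive_primitive hc t1.
apply: (is_derive_eq (is_deriveN (is_deriveM d1 d2))).
rewrite /linear_ode_sol /GRing.scale /= mulrA -expRD.
rewrite (_ : - c * t + c * t = 0) ?expR0; ring.
Qed.

(** The mean value inequality on each of the [n.+1] subintervals. Riemann sums
    serve only to see that a time integral of measurable functions of a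
    parameter is measurable in the parameter. *)
Lemma riemann_sum_le (F h : R -> R) (L T : R) n : 0 <= T ->
  (forall t, 0 <= t <= T -> is_derive t 1 F (h t)) ->
  (forall s t, 0 <= s <= t -> t <= T -> `|h t - h s| <= L * (t - s)) ->
  `|F T - F 0 - \sum_(0 <= k < n.+1) h (T * (k%:R / n.+1%:R)) * (T / n.+1%:R)|
    <= L * T ^+ 2 / n.+1%:R.
Proof.
move=> T0 dF hL.
pose p (k : nat) := T * (k%:R / n.+1%:R).
have n0 : (0 : R) < n.+1%:R by rewrite ltr0n.
have p0 : p 0%N = 0 by rewrite /p mul0r mulr0.
have pn : p n.+1 = T by rewrite /p divff ?mulr1// gt_eqF.
have pS k : p k.+1 - p k = T / n.+1%:R.
  by rewrite /p -addn1 natrD; field; rewrite gt_eqF.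
have d0 : 0 <= T / n.+1%:R by rewrite divr_ge0 // ltW.
have p_ge0 k : 0 <= p k by rewrite /p mulr_ge0// divr_ge0// ltW.
have p_leT k : (k <= n.+1)%N -> p k <= T.
  by move=> kn; rewrite /p ler_piMr// ler_pdivrMr// mul1r ler_nat.
have -> : F T - F 0 = \sum_(0 <= k < n.+1) (F (p k.+1) - F (p k)).
  by rewrite telescope_sumr// pn p0.
rewrite -sumrB.
have L0 : 0 < T -> 0 <= L.
  move=> Tpos; have := hL 0 T; rewrite lexx T0 lexx => /(_ isT isT) h1.
  by have := le_trans (normr_ge0 _) h1; rewrite subr0 pmulr_lge0.
apply: (@le_trans _ _ (\sum_(0 <= k < n.+1) L * (T / n.+1%:R) ^+ 2)); last first.
  rewrite sumr_const_nat subn0 -[leLHS]mulr_natr expr_div_n.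
  rewrite (_ : L * (T ^+ 2 / n.+1%:R ^+ 2) * n.+1%:R = L * T ^+ 2 / n.+1%:R) //.
  by field; rewrite gt_eqF.
apply: (le_trans (ler_norm_sum _ _ _)); rewrite big_nat [leRHS]big_nat.
apply: ler_sum => k /andP[_ kn].
pose g s := F s - h (p k) * s.
have pk : p k <= p k.+1 by rewrite -subr_ge0 pS.
have dg s : p k <= s <= p k.+1 -> is_derive s 1 g (h s - h (p k)).
  move=> /andP[ks sk].
  have ds : is_derive s 1 F (h s).
    by apply: dF; rewrite (le_trans (p_ge0 k) ks) (le_trans sk (p_leT _ kn)).
  apply: (is_derive_eq (is_deriveB ds
    (is_deriveZ (f := id) (h (p k)) (is_derive_id s 1)))).
  by rewrite /GRing.scale /= mulr1.
have : `|g (p k.+1) - g (p k)| <= (L * (T / n.+1%:R)) * (p k.+1 - p k).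
  apply: (@mean_value_le _ g (fun s => h s - h (p k))) => //.
  - by move=> s /andP[/ltW h1 /ltW h2]; apply: dg; rewrite h1 h2.
  - apply: derivable_within_continuous => s; rewrite in_itv /= => /dg [].
    by [].
  - move=> s /andP[ks sk].
    have sT : s <= T by rewrite (le_trans (ltW sk))// p_leT.
    apply: (le_trans (hL _ _ _ sT)); first by rewrite p_ge0 ltW.
    apply: ler_wpM2l; last by rewrite -(pS k) lerD2r ltW.
    by apply: L0; rewrite (lt_le_trans _ sT)// (le_lt_trans (p_ge0 k) ks).
rewrite pS -[leRHS]mulrA -expr2; congr (`| _ | <= _).
by rewrite /g -(pS k); ring.
Qed.

End primitive.

Section measurable_primitive.
Context {disp : measure_display} {X : measurableType disp} {R : realType}.

Lemma measurable_linear_ode_sol (c : R) (f : R -> X -> R) (C K T : R) :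
  0 <= T -> 0 <= c ->
  (forall x, continuous (f ^~ x)) ->
  (forall t, 0 <= t -> measurable_fun setT (f t)) ->
  (forall t x, 0 <= t -> `|f t x| <= C) ->
  (forall s t x, 0 <= s <= t -> `|f t x - f s x| <= K * (t - s)) ->
  measurable_fun setT (fun x => linear_ode_sol c (f ^~ x) T).
Proof.
move=> T0 c0 fc mf fC fK.
apply: measurable_funN; apply: measurable_funM => //.
pose h (s : R) x := expR (c * s) * f s x.
pose S (n : nat) x := \sum_(0 <= k < n.+1) h (T * (k%:R / n.+1%:R)) x * (T / n.+1%:R).
apply: (@measurable_fun_cvg _ _ _ _ S).
  move=> n; apply: measurable_sum => k.
  apply: measurable_funM => //; apply: measurable_funM => //.
  by apply: mf; rewrite mulr_ge0// divr_ge0.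
move=> x _.
pose L := expR (c * T) * (c * C + K).
have hL s t : 0 <= s <= t -> t <= T -> `|h t x - h s x| <= L * (t - s).
  move=> /andP[s0 st] tT.
  have -> : h t x - h s x = (expR (c * t) - expR (c * s)) * f t x
      + expR (c * s) * (f t x - f s x) by rewrite /h; ring.
  have e1 : `|expR (c * t) - expR (c * s)| <= c * expR (c * T) * (t - s).
    apply: (@mean_value_le _ (fun s => expR (c * s)) (fun s => c * expR (c * s))) => //.
    - by move=> u _; exact: is_derive_expRM.
    - exact/continuous_subspaceT/continuous_expRM.
    - move=> u /andP[su ut]; rewrite normrM (ger0_norm c0) ger0_norm ?expR_ge0//.
      by rewrite ler_wpM2l// ler_expR ler_wpM2l// (le_trans (ltW ut)).
  apply: (le_trans (ler_normD _ _)); rewrite !normrM (ger0_norm (expR_ge0 _)).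
  have -> : L * (t - s) = c * expR (c * T) * (t - s) * C + expR (c * T) * (K * (t - s)).
    by rewrite /L; ring.
  apply: lerD; apply: ler_pM => //.
  - by rewrite fC// (le_trans s0).
  - by rewrite ler_expR ler_wpM2l// (le_trans st).
  - by rewrite fK// s0.
have hc : continuous (h ^~ x).
  by move=> s; apply: cvgM; [exact: continuous_expRM|exact: fc].
have dist n : `|primitive (h ^~ x) T - S n x| <= L * T ^+ 2 / n.+1%:R.
  have := @riemann_sum_le _ (primitive (h ^~ x)) (h ^~ x) L T n T0 _ hL.
  rewrite primitive0 subr0; apply=> t /andP[t0 _].
  by apply: is_derive_primitive => //; rewrite (lt_le_trans _ t0)// ltrN10.
apply/cvgrPdist_le => e e0.
have : L * T ^+ 2 / n.+1%:R @[n --> \oo] --> (0 : R).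
  rewrite -(mulr0 (L * T ^+ 2)); apply: cvgM; first exact: cvg_cst.
  exact: cvg_harmonic.
move=> /cvgr_lt /(_ e e0) He.
by apply: filterS He => n He; exact: le_trans (dist n) (ltW He).
Qed.

End measurable_primitive.

(** * Picard iteration for families of linear equations *)

Section picard.
Context {disp : measure_display} {X : measurableType disp} {R : realType}.
Variables (c C K L : R) (Phi : (R -> X -> R) -> R -> X -> R).
Implicit Types (s t u : R) (z : R -> X -> R) (x : X).
Hypotheses (c0 : 0 < c) (C0 : 0 <= C) (L0 : 0 <= L).

(** The estimates that Picard iterates share, stable under pointwise limits. *)
Record admissible (z : R -> X -> R) : Prop := Admissible {
  adm_measurable : forall t, 0 <= t -> measurable_fun setT (z t) ;
  adm_bounded : forall t x, 0 <= t -> `|z t x| <= C / c ;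
  adm_lipschitz : forall s t x, 0 <= s <= t ->
    `|z t x - z s x| <= (C + C) * (t - s) ;
  adm0 : forall x, z 0 x = 0 }.

Hypothesis Phi_measurable : forall z, admissible z ->
  forall t, 0 <= t -> measurable_fun setT (Phi z t).
Hypothesis Phi_bounded : forall z, admissible z ->
  forall t x, 0 <= t -> `|Phi z t x| <= C.
Hypothesis Phi_lipschitz : forall z, admissible z ->
  forall s t x, 0 <= s <= t -> `|Phi z t x - Phi z s x| <= K * (t - s).
Hypothesis Phi_contract : forall z z', admissible z -> admissible z' ->
  forall t, 0 <= t -> forall dlt : R, (forall x, `|z t x - z' t x| <= dlt) ->
  forall x, `|Phi z t x - Phi z' t x| <= L * dlt.

(** Evaluating the right-hand side at [`|s|] extends the path to negative times,
    so that two-sided derivatives exist at 0. *)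
Let step (z : R -> X -> R) (t : R) (x : X) : R :=
  linear_ode_sol c (fun s : R => Phi z `|s| x) t.

Let Phi_cont z x : admissible z -> continuous (fun s : R => Phi z `|s| x).
Proof.
move=> az t; apply/(@cvgrPdist_le _ R^o) => e e0.
have K0 : 0 <= K.
  have := Phi_lipschitz az x (s := 0) (t := 1).
  rewrite lexx ler01 => /(_ isT) h; have := le_trans (normr_ge0 _) h.
  by rewrite subr0 mulr1.
have h : \forall s \near nbhs (t : R), (K + 1) * `|t - (s : R)| <= e.
  have K1 : 0 < K + 1 by lra.
  exists (e / (K + 1)) => /=; first by rewrite divr_gt0.
  move=> s /= ts; rewrite mulrC -ler_pdivlMr// ltW//.
apply: filterS h => s hs; apply: le_trans hs.
have lip a b : 0 <= a -> 0 <= b -> `|Phi z a x - Phi z b x| <= K * `|a - b|.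
  move=> a0 b0; case: (leP b a) => ab.
    by rewrite (ger0_norm (x := a - b)) ?subr_ge0//; apply: Phi_lipschitz; rewrite ?b0.
  rewrite distrC (distrC a) (gtr0_norm (x := b - a)) ?subr_gt0//.
  by apply: Phi_lipschitz; rewrite ?a0 ?ltW.
apply: (le_trans (lip _ _ (normr_ge0 _) (normr_ge0 _))).
apply: ler_pM => //; first by rewrite lerDl.
exact: ler_dist_dist.
Qed.

Let step_derive z x t : admissible z -> -1 < t ->
  is_derive t 1 ((step z)^~ x) (- Phi z `|t| x - c * step z t x).
Proof. by move=> az t1; apply: is_derive_linear_ode_sol => //; exact: Phi_cont. Qed.

Let step0 z x : step z 0 x = 0.
Proof. exact: linear_ode_sol0. Qed.

Let N1lt0 (t : R) : 0 <= t -> -1 < t.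
Proof. by move=> t0; rewrite (lt_le_trans _ t0)// ltrN10. Qed.

Let step_within z x : admissible z -> {within `[0, +oo[, continuous ((step z)^~ x)}.
Proof.
move=> az; apply: derivable_within_continuous => s; rewrite in_itv /= andbT => s0.
by have [] := @step_derive _ x _ az (N1lt0 s0).
Qed.

Let step_bounded z : admissible z -> forall t x, 0 <= t -> `|step z t x| <= C / c.
Proof.
move=> az t x t0.
have c0' : 0 < 0 + c by rewrite add0r.
have := @linear_ode_le _ c 0 C ((step z)^~ x) (fun s : R => Phi z `|s| x) c0' C0
  (@step_within _ x az) (step0 z x).
rewrite add0r => h; have := h _ _ t t0; rewrite mul0r expR0 mulr1; apply.
  by move=> s s0; apply: step_derive => //; apply: N1lt0; exact: ltW.
by move=> s s0; rewrite mul0r expR0 mulr1; apply: Phi_bounded.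
Qed.

Let step_admissible z : admissible z -> admissible (step z).
Proof.
move=> az; split.
- move=> t t0; apply: (@measurable_linear_ode_sol _ _ _ c
    (fun (s : R) x => Phi z `|s| x) C K) => //.
  + exact: ltW.
  + by move=> x; exact: Phi_cont.
  + by move=> s s0; exact: Phi_measurable.
  + by move=> s x s0; exact: Phi_bounded.
  + move=> s u x /andP[s0 su]; rewrite (ger0_norm s0) (ger0_norm (le_trans s0 su)).
    by rewrite Phi_lipschitz// s0.
- exact: step_bounded.
- move=> s t x /andP[s0 st].
  apply: (@mean_value_le _ ((step z)^~ x)
    (fun t : R => - Phi z `|t| x - c * step z t x)) => //.
  + move=> u /andP[su _]; apply: step_derive => //; apply: N1lt0.
    by rewrite (le_trans s0) ?ltW.
  + apply: continuous_subspaceW (@step_within _ x az) => u /=.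
    by rewrite !in_itv /= andbT => /andP[su _]; exact: le_trans su.
  + move=> u /andP[su _]; have u0 : 0 <= u by rewrite (le_trans s0) ?ltW.
    apply: (le_trans (ler_normB _ _)); rewrite normrN lerD ?Phi_bounded//.
    by rewrite normrM gtr0_norm// mulrC -ler_pdivlMr// step_bounded.
- by move=> x; exact: step0.
Qed.

(** With [lam = 2 L] one step halves the distance in the norm
    [sup_t expR (- lam * t) * sup_x |.|]. *)
Let lam := L + L.

Let step_contract z z' D : admissible z -> admissible z' -> 0 <= D ->
  (forall t x, 0 <= t -> `|z t x - z' t x| <= D * expR (lam * t)) ->
  forall t x, 0 <= t -> `|step z t x - step z' t x| <= D / 2 * expR (lam * t).
Proof.
move=> az az' D0 zz' t x t0.
have lc : 0 < lam + c by rewrite ltr_wpDl// addr_ge0.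
have h := @linear_ode_le _ c lam (L * D) (fun s : R => step z s x - step z' s x)
  (fun s : R => Phi z `|s| x - Phi z' `|s| x) lc (mulr_ge0 L0 D0).
apply: le_trans (h _ _ _ _ _ t0) _.
- apply/subspace_continuousP => s s0.
  by apply: cvgB; [have /subspace_continuousP := @step_within _ x az
                  |have /subspace_continuousP := @step_within _ x az'] => /(_ s s0).
- by rewrite !step0 subrr.
- move=> s /ltW/N1lt0 s1.
  apply: (is_derive_eq (is_deriveB (@step_derive _ x _ az s1)
    (@step_derive _ x _ az' s1))).
  ring.
- move=> s /ltW s0; rewrite (ger0_norm s0) -mulrA.
  by apply: Phi_contract => // y; exact: zz'.
- rewrite mulrAC; apply: ler_wpM2r; first exact: expR_ge0.
  rewrite ler_pdivrMr//.
  rewrite (_ : D / 2 * (lam + c) = L * D + D / 2 * c); last first.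
    by rewrite /lam; lra.
  by rewrite lerDl; apply: mulr_ge0; [exact: divr_ge0|exact: ltW].
Qed.

Let iter_step n := iter n step (fun _ _ => 0).

Let iter_admissible n : admissible (iter_step n).
Proof.
elim: n => [|n ih]; last exact: step_admissible.
split => [t _|t x _|s t x /andP[_ st]|//].
- exact: measurable_cst.
- by rewrite /iter_step /= normr0 divr_ge0// ltW.
- rewrite /iter_step /= subrr normr0; apply: mulr_ge0; first exact: addr_ge0.
  by rewrite subr_ge0.
Qed.

Let iter_dist n t x : 0 <= t ->
  `|iter_step n.+1 t x - iter_step n t x| <= C / c * expR (lam * t) * 2^-1 ^+ n.
Proof.
have Cc : 0 <= C / c by rewrite divr_ge0 // ltW.
suff h m : forall t x, 0 <= t -> `|iter_step m.+1 t x - iter_step m t x|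
     <= C / c * 2^-1 ^+ m * expR (lam * t) by move=> t0; rewrite mulrAC; exact: h.
elim: m => [|m ih] s y s0.
  rewrite expr0 mulr1 /= subr0.
  apply: le_trans (@step_bounded _ (iter_admissible 0) _ y s0) _.
  by rewrite ler_peMr// -expR0 ler_expR mulr_ge0// addr_ge0.
rewrite exprSr mulrA; apply: step_contract; last exact: s0; last exact: ih.
- exact: (iter_admissible m.+1).
- exact: (iter_admissible m).
- by apply: mulr_ge0 => //; rewrite exprn_ge0// invr_ge0.
Qed.

(** The iterates converge geometrically in the weighted norm. Their limit [z] is
    a fixed point of [step], and it is [step z] that is seen to be
    differentiable. *)
Lemma picard : exists z, admissible z /\ forall t x, 0 <= t ->
  is_derive t 1 (z ^~ x) (- Phi z t x - c * z t x).
Proof.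
have Cc : 0 <= C / c by rewrite divr_ge0 // ltW.
pose z t x := limn (fun n => iter_step n t x).
have zc t x : 0 <= t -> iter_step n t x @[n --> \oo] --> z t x.
  by move=> t0; exact: (half_geometric_cvg (fun n => iter_dist n x t0)).1.
have zd t x n : 0 <= t ->
    `|z t x - iter_step n t x| <= 2 * (C / c) * 2^-1 ^+ n * expR (lam * t).
  move=> t0; rewrite mulrAC -(mulrA 2).
  exact: (half_geometric_cvg (fun n => iter_dist n x t0)).2.
have az : admissible z.
  split.
  - move=> t t0; apply: (@measurable_fun_cvg _ _ _ _ (fun n => iter_step n t)).
      by move=> n; apply: adm_measurable => //; exact: iter_admissible.
    by move=> x _; exact: zc.
  - move=> t x t0; apply: (cvgr_to_le (cvg_norm (zc t x t0))).
    by apply: nearW => n; apply: adm_bounded => //; exact: iter_admissible.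
  - move=> s t x /andP[s0 st]; have t0 := le_trans s0 st.
    apply: (cvgr_to_le (cvg_norm (cvgB (zc t x t0) (zc s x s0)))).
    by apply: nearW => n; apply: adm_lipschitz; [exact: iter_admissible|rewrite s0].
  - move=> x; apply/eqP; rewrite -normr_le0.
    apply: (cvgr_to_le (cvg_norm (zc 0 x (lexx 0)))).
    by apply: nearW => n; rewrite (adm0 (iter_admissible n)) normr0.
have stepz t x : 0 <= t -> step z t x = z t x.
  move=> t0; apply/eqP; rewrite -subr_eq0; apply/eqP.
  apply: (@half_geometric_eq0 _ _ (2 * (C / c) * expR (lam * t))) => n.
  rewrite -(subrKA (iter_step n.+1 t x)) (le_trans (ler_normD _ _))//.
  have e2 : 0 <= 2 * (C / c) * 2^-1 ^+ n.
    by apply: mulr_ge0; [apply: mulr_ge0|rewrite exprn_ge0// invr_ge0].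
  have h1 : `|step z t x - iter_step n.+1 t x|
      <= 2 * (C / c) * 2^-1 ^+ n / 2 * expR (lam * t).
    apply: (step_contract az (iter_admissible n) e2) t0 => s y s0.
    exact: zd.
  have h2 := zd t x n.+1 t0; rewrite distrC in h2.
  apply: (le_trans (lerD h1 h2)); rewrite exprS.
  rewrite le_eqVlt; apply/orP; left; apply/eqP.
  by field; rewrite ?gt_eqF.
exists (step z); split; first exact: step_admissible.
move=> t x t0; apply: (is_derive_eq (@step_derive _ x _ az (N1lt0 t0))).
rewrite (ger0_norm t0); congr (- _ - _); apply/eqP; rewrite -subr_eq0 -normr_le0.
rewrite -(mulr0 L); apply: Phi_contract => //; first exact: step_admissible.
by move=> y; rewrite stepz// subrr normr0.
Qed.

End picard.

(** * One-sided derivatives *)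

Section derivative_within.
Variable R : realType.
Implicit Types (D : set R) (f g : R -> R) (t s v e : R).

(** The one-sided derivative that defines solutions, in a form that can be
    compared with the two-sided one. *)
Lemma has_derivative_withinP D f t v : has_derivative_within D f t v <->
  forall e, 0 < e -> exists2 dlt : R, 0 < dlt & forall s, D s -> s != t ->
    `|s - t| < dlt -> `|v - (f s - f t) / (s - t)| <= e.
Proof.
rewrite /has_derivative_within; split => [/cvgrPdist_le h e e0|h].
  have /nbhs_ballP[r /= r0 hr] := h e e0.
  by exists r => // s Ds st sr; apply: hr => //; rewrite /ball /= distrC.
apply/(@cvgrPdist_le _ R^o) => e e0; have [r r0 hr] := h e e0.
apply/nbhs_ballP; exists r => //= s; rewrite /ball /= distrC => sr st Ds.
exact: hr.
Qed.

Lemma is_deriveP f t v : is_derive t 1 f v <-> has_derivative_within setT f t v.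
Proof.
split => [[fd fv]|/has_derivative_withinP h].
  apply/has_derivative_withinP => e e0.
  move: fd; rewrite /derivable => /cvg_ex fd.
  have : h^-1 *: (f (h *: 1 + t) - f t) @[h --> 0^'] --> v.
    by move: fd => [l fl]; rewrite -fv /derive (cvg_lim _ fl).
  move=> /(@cvgrPdist_le _ R^o) /(_ e e0) /nbhs_ballP[r /= r0 hr].
  exists r => // s _ st sr; have := hr (s - t).
  rewrite /ball /= sub0r normrN subr_eq0 => /(_ sr st).
  by rewrite /GRing.scale /= mulr1 subrK mulrC.
have fl : h^-1 *: (f (h *: 1 + t) - f t) @[h --> 0^'] --> v.
  apply/(@cvgrPdist_le _ R^o) => e e0; have [r r0 hr] := h e e0.
  apply/nbhs_ballP; exists r => //= s; rewrite /ball /= sub0r normrN => sr s0.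
  have := hr (s + t) I; rewrite addrK; move=> /(_ _ sr).
  rewrite -subr_eq0 addrK => /(_ s0).
  by rewrite /GRing.scale /= mulr1 mulrC.
split; first by apply/cvg_ex; exists v.
exact: (cvg_lim _ fl).
Qed.

Lemma is_derive_within D f t v : is_derive t 1 f v -> has_derivative_within D f t v.
Proof.
move=> /is_deriveP/has_derivative_withinP h; apply/has_derivative_withinP => e e0.
by have [r r0 hr] := h e e0; exists r => // s _; exact: hr.
Qed.

Lemma within_is_derive D f t v : nbhs t D -> has_derivative_within D f t v ->
  is_derive t 1 f v.
Proof.
move=> /nbhs_ballP[a /= a0 aD] /has_derivative_withinP h; apply/is_deriveP.
apply/has_derivative_withinP => e e0; have [r r0 hr] := h e e0.
exists (Num.min a r) => [|s _ st]; first by rewrite lt_min a0.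
rewrite lt_min => /andP[sa sr]; apply: hr => //.
by apply: aD; rewrite /ball /= distrC.
Qed.

Lemma has_derivative_within_lipschitz D f t v : has_derivative_within D f t v ->
  exists2 dlt : R, 0 < dlt & forall s, D s -> `|s - t| < dlt ->
    `|f s - f t| <= (`|v| + 1) * `|s - t|.
Proof.
move=> /has_derivative_withinP /(_ 1 ltr01)[r r0 hr]; exists r => // s Ds sr.
have [->|st] := eqVneq s t; first by rewrite !subrr normr0 mulr0.
have st0 : 0 < `|s - t| by rewrite normr_gt0 subr_eq0.
rewrite -ler_pdivrMr// -normfV -normrM.
rewrite -[(f s - f t) / (s - t)](subKr v) (le_trans (ler_normB _ _))//.
by rewrite lerD2l hr.
Qed.

Lemma has_derivative_within_cvg D f t v : has_derivative_within D f t v ->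
  f s @[s --> within D (nbhs t)] --> f t.
Proof.
move=> /has_derivative_within_lipschitz[r r0 hr]; apply/(@cvgrPdist_le _ R^o) => e e0.
have v0 : 0 < `|v| + 1 by rewrite ltr_wpDl.
apply/nbhs_ballP; exists (Num.min r (e / (`|v| + 1))) => /=.
  by rewrite lt_min r0 divr_gt0.
move=> s; rewrite /ball /= distrC lt_min => /andP[sr se] Ds.
rewrite distrC (le_trans (hr s Ds sr))// mulrC -ler_pdivlMr//.
exact: ltW.
Qed.

Lemma has_derivative_within_eq D f g t v w : D t -> (forall s, D s -> f s = g s) ->
  has_derivative_within D f t v -> v = w -> has_derivative_within D g t w.
Proof.
move=> Dt fg /has_derivative_withinP h <-; apply/has_derivative_withinP => e e0.
have [r r0 hr] := h e e0; exists r => // s Ds; rewrite -!fg//; exact: hr.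
Qed.

Lemma has_derivative_within_div D f g t v w : g t != 0 ->
  has_derivative_within D f t v -> has_derivative_within D g t w ->
  has_derivative_within D (fun s => f s / g s) t ((v - f t / g t * w) / g t).
Proof.
move=> gt0 fv gw.
have FD : Filter (within D t^') by exact: within_filter.
have gc : g s @[s --> within D t^'] --> g t.
  move=> A /(has_derivative_within_cvg gw); rewrite /= /nbhs /= /within /=.
  by apply: filterS => s hs _ Ds; exact: hs.
have : ((f s - f t) / (s - t) - f t / g t * ((g s - g t) / (s - t))) / g s
    @[s --> within D t^'] --> (v - f t / g t * w) / g t.
  apply: cvgM; last exact: cvgV.
  by apply: cvgB => //; apply: cvgM => //; exact: cvg_cst.
apply: cvg_trans; apply: near_eq_cvg.
have gs : \forall s \near within D t^', g s != 0.
  have h : \forall s \near within D t^', `|g t - g s| < `|g t|.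
    by move/cvgrPdist_lt : gc; apply; rewrite normr_gt0.
  apply: filterS h => s; apply: contraTneq => ->.
  by rewrite subr0 ltxx.
have ts : \forall s \near within D t^', s != t.
  exact: (@filterE _ (nbhs t) _ (fun s => s != t -> D s -> s != t)).
apply: (@filterS2 _ _ FD _ _ _ _ gs ts) => s gs0 st; field.
by rewrite gs0 gt0 subr_eq0 st.
Qed.

End derivative_within.

Section derivative_within_integral.
Context {disp : measure_display} {X : measurableType disp} {R : realType}.
Variable mu : {measure set X -> \bar R}.

(** Dominated convergence along sequences. Off [D] the difference quotient is
    replaced by its limit [w], which turns the limit within [D] into a limit
    along a punctured neighborhood, where sequences suffice. *)
Lemma has_derivative_within_integral (D : set R) (u : R -> X -> R)
    (w G : X -> R) (t : R) : D t ->
  (forall s, D s -> mu.-integrable setT (EFin \o u s)) ->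
  measurable_fun setT w ->
  mu.-integrable setT (EFin \o G) -> (forall x, `|w x| <= G x) ->
  (forall s x, D s -> `|u s x - u t x| <= G x * `|s - t|) ->
  (forall x, has_derivative_within D (u ^~ x) t (w x)) ->
  has_derivative_within D (fun s => \int[mu]_x u s x) t (\int[mu]_x w x).
Proof.
move=> Dt ui mw Gi wG uG uw.
have mu_ s : D s -> measurable_fun setT (u s).
  by move=> /ui/integrableP[/measurable_EFinP].
have wi : mu.-integrable setT (EFin \o w).
  apply: le_integrable Gi => //; first exact/measurable_EFinP.
  by move=> x _; rewrite /= lee_fin (le_trans (wG x))// ler_norm.
pose q s x := if `[< D s >] then (u s x - u t x) / (s - t) else w x.
have mq s : measurable_fun setT (q s).
  rewrite /q; case: asboolP => // Ds; apply: measurable_funM => //.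
  by apply: measurable_funB; exact: mu_.
have qE s : D s -> \int[mu]_x q s x
    = (\int[mu]_x u s x - \int[mu]_x u t x) / (s - t).
  move=> Ds; rewrite /q asboolT//.
  rewrite RintegralZr//; first by rewrite RintegralB//; exact: ui.
  by apply: integrable_EFinB; exact: ui.
suff h : \int[mu]_x q s x @[s --> t^'] --> \int[mu]_x w x.
  rewrite /has_derivative_within.
  have {}h : \int[mu]_x q s x @[s --> within D t^'] --> \int[mu]_x w x.
    exact: cvg_within_filter.
  apply: cvg_trans h; apply: near_eq_cvg.
  exact: (@filterE _ t^' _ (fun s => D s -> _ = _)).
apply/cvgr_dnbhsP => s_ [st sc].
have qw x : q (s_ n) x @[n --> \oo] --> w x.
  apply/(@cvgrPdist_le _ R^o) => e e0.
  have /has_derivative_withinP/(_ e e0)[r r0 hr] := uw x.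
  have : \forall n \near \oo, `|t - s_ n| < r by move/cvgrPdist_lt : sc; apply.
  apply: filterS => n sn; rewrite /q; case: asboolP => [Ds|_].
    by apply: hr => //; rewrite distrC.
  by rewrite subrr normr0 ltW.
have := @dominated_cvg _ _ _ mu setT measurableT
  (fun n x => (q (s_ n) x)%:E) (EFin \o w) (EFin \o G).
move=> /(_ _ _ _ Gi) h.
apply: fine_cvg; rewrite fineK; last exact: integrable_fin_num.
apply: h => //.
- by move=> n; exact/measurable_EFinP.
- by move=> x _; apply: cvg_EFin; [exact: nearW|exact: qw].
- move=> n x _; rewrite lee_fin /q; case: asboolP => // Ds.
  rewrite normrM normfV ler_pdivrMr; last by rewrite normr_gt0 subr_eq0.
  exact: uG.
Qed.

End derivative_within_integral.

(** * Gibbs densities *)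

Section gibbs.
Variables (R : realType) (d : nat) (pi : density R d).
Local Notation mu := (lebesgue_rV R d).
Implicit Types (u v : Rd R d -> R) (B dlt : R).

Definition partition u : R := \int[mu]_x (u x * pi x).

Lemma integrable_mul_pdf u B : measurable_fun setT u -> (forall x, `|u x| <= B) ->
  mu.-integrable setT (EFin \o (fun x => u x * pi x)).
Proof.
move=> mu_ uB; apply: (@integrable_le_pdf _ _ pi _ B).
  by apply: measurable_funM => //; exact: measurable_pdf.
by move=> x; rewrite normrM (ger0_norm (pdf_ge0 _ _)) ler_wpM2r ?pdf_ge0.
Qed.

Lemma le_partition u v B : measurable_fun setT u -> measurable_fun setT v ->
  (forall x, `|u x| <= B) -> (forall x, `|v x| <= B) ->
  (forall x, u x <= v x) -> partition u <= partition v.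
Proof.
move=> mu_ mv uB vB uv; apply: le_Rintegral => //.
- exact: (integrable_mul_pdf mu_ uB).
- exact: (integrable_mul_pdf mv vB).
- by move=> x _; rewrite ler_wpM2r ?pdf_ge0.
Qed.

(** [pi] has mass 1, so averaging against it does not increase the uniform
    distance. *)
Lemma partition_dist_le u v B dlt : measurable_fun setT u -> measurable_fun setT v ->
  (forall x, `|u x| <= B) -> (forall x, `|v x| <= B) ->
  (forall x, `|u x - v x| <= dlt) -> `|partition u - partition v| <= dlt.
Proof.
move=> mu_ mv uB vB uv.
rewrite /partition -RintegralB//; [|exact: (integrable_mul_pdf mu_ uB)|
  exact: (integrable_mul_pdf mv vB)].
under eq_Rintegral do rewrite -mulrBl.
have muv : measurable_fun setT (fun x => u x - v x) by exact: measurable_funB.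
have iuv := integrable_mul_pdf muv uv.
apply: (le_trans (le_normr_Rintegral _ iuv)) => //.
have -> : dlt = \int[mu]_x (dlt * pi x).
  by rewrite RintegralZl// ?Rintegral_pdf ?mulr1//; exact: integrable_pdf.
apply: le_Rintegral => //.
- exact: (integrable_norm iuv).
- by apply: integrable_EFinZ; exact: integrable_pdf.
- by move=> x _; rewrite normrM (ger0_norm (pdf_ge0 _ _)) ler_wpM2r ?pdf_ge0.
Qed.

Lemma normalized_density u B : measurable_fun setT u ->
  (forall x, 0 <= u x <= B) -> 0 < partition u ->
  exists m : density R d, forall x, m x = u x * pi x / partition u.
Proof.
move=> mu_ uB Z0.
have uB' x : `|u x| <= B by have /andP[? ?] := uB x; rewrite ger0_norm.
have ui := integrable_mul_pdf mu_ uB'.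
have mm : measurable_fun setT (fun x => u x * pi x / partition u).
  by do 2 apply: measurable_funM => //; exact: measurable_pdf.
have m0 x : 0 <= u x * pi x / partition u.
  by have /andP[? _] := uB x; rewrite divr_ge0 ?mulr_ge0 ?pdf_ge0// ltW.
have m1 : (\int[mu]_x (u x * pi x / partition u)%:E = 1)%E.
  under eq_integral do rewrite EFinM.
  rewrite integralZr//.
  rewrite (_ : (\int[mu]_x (u x * pi x)%:E)%E = (partition u)%:E).
    by rewrite -EFinM divff// gt_eqF.
  by rewrite /partition /Rintegral fineK//; exact: integrable_fin_num.
by exists (Density mm m0 m1).
Qed.

(** Meant for bounded [u] with a positive partition function; [pi] is a default
    value. *)
Definition gibbs u : density R d :=
  if pselect (exists m : density R d, forall x, m x = u x * pi x / partition u)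
  is left h then sval (cid h) else pi.

Lemma gibbsE u B : measurable_fun setT u ->
  (forall x, 0 <= u x <= B) -> 0 < partition u ->
  forall x, gibbs u x = u x * pi x / partition u.
Proof.
move=> mu_ uB Z0; rewrite /gibbs; case: pselect => [h|].
  by move=> x; case: (cid h) => m /= ->.
by move=> h; exfalso; apply: h; exact: (normalized_density mu_ uB Z0).
Qed.

(** With [Z], [Z'] the two partition functions,
    [u / Z - v / Z' = (u - v) / Z + (Z' - Z) / Z * (v / Z')], and [|Z - Z'|] is at
    most [dlt]: both terms contribute [dlt / Z]. *)
Lemma gibbs_tv u v B dlt : measurable_fun setT u -> measurable_fun setT v ->
  (forall x, 0 <= u x <= B) -> (forall x, 0 <= v x <= B) ->
  0 < partition u -> 0 < partition v ->
  (forall x, `|u x - v x| <= dlt) ->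
  \int[mu]_x `|gibbs u x - gibbs v x| <= 2 * dlt / partition u.
Proof.
move=> mu_ mv uB vB Zu Zv uv.
have uB' x : `|u x| <= B by have /andP[? ?] := uB x; rewrite ger0_norm.
have vB' x : `|v x| <= B by have /andP[? ?] := vB x; rewrite ger0_norm.
have Zuv := partition_dist_le mu_ mv uB' vB' uv.
have -> : 2 * dlt / partition u
    = \int[mu]_x (dlt / partition u * (pi x + gibbs v x)).
  rewrite RintegralZl//; last first.
    by apply: integrable_EFinD; exact: integrable_pdf.
  rewrite RintegralD//; [|exact: integrable_pdf..].
  by rewrite !Rintegral_pdf; ring.
apply: le_Rintegral => //.
- exact: integrable_dist_pdf.
- by apply: integrable_EFinZ; apply: integrable_EFinD; exact: integrable_pdf.
move=> x _; rewrite (gibbsE mu_ uB Zu) (gibbsE mv vB Zv).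
have /andP[v0 _] := vB x; have p0 := pdf_ge0 pi x.
have -> : u x * pi x / partition u - v x * pi x / partition v
   = (u x - v x) * (pi x / partition u)
     + (partition v - partition u) * (v x * pi x / partition v / partition u).
  by field; rewrite !gt_eqF.
rewrite (le_trans (ler_normD _ _))// !normrM.
have -> : dlt / partition u * (pi x + v x * pi x / partition v)
  = dlt * (pi x / partition u) + dlt * (v x * pi x / partition v / partition u).
  by field; rewrite !gt_eqF.
rewrite (ger0_norm p0) (ger0_norm v0) !normfV (gtr0_norm Zu) (gtr0_norm Zv).
by rewrite lerD// ler_wpM2r// ?divr_ge0 ?mulr_ge0 ?invr_ge0 ?(ltW Zu) ?(ltW Zv)// distrC.
Qed.

End gibbs.

(** * Unnormalized densities *)

Section weight.
Variables (R : realType) (c : R).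
Hypothesis c0 : 0 < c.
Implicit Types (g t s z K B : R).

Lemma normr_mul_ln_le (w B : R) : 1 <= B -> 0 <= w <= B -> `|w * ln w| <= B ^+ 2.
Proof.
move=> B1 /andP[]; rewrite le_eqVlt => /predU1P[<- _|w0 wB].
  by rewrite mul0r normr0 sqr_ge0.
have BB : B <= B ^+ 2 by rewrite expr2 ler_peMl// (le_trans _ B1).
have [w1|w1] := leP 1 w.
  rewrite ger0_norm ?mulr_ge0 ?ln_ge0// ?(ltW w0)// expr2.
  by apply: ler_pM; rewrite ?ln_ge0 ?(ltW w0)// (le_trans (ltW (ln_sublinear w0))).
rewrite normrM (gtr0_norm w0) (ler0_norm (ln_le0 (ltW w1))).
have : - ln w <= w^-1.
  by rewrite -lnV ?posrE// ltW// ln_sublinear// invr_gt0.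
rewrite -(ler_pM2l w0) divff ?gt_eqF// => h; apply: le_trans h _.
by rewrite (le_trans B1).
Qed.

(** The unnormalized density relative to [pi] at time [t], when its initial value
    is [g] and the drift accumulated up to [t] is [z]. *)
Definition weight g t z := g `^ expR (- c * t) * expR z.

Lemma theta_le1 t : 0 <= t -> expR (- c * t) <= 1.
Proof. by move=> t0; rewrite -expR0 ler_expR mulNr oppr_le0 mulr_ge0// ltW. Qed.

Lemma powR_theta_le g t B : 1 <= B -> 0 <= t -> 0 <= g <= B -> g `^ expR (- c * t) <= B.
Proof.
move=> B1 t0 /andP[g0 gB]; have B0 : 0 <= B by rewrite (le_trans _ B1).
apply: (@le_trans _ _ (B `^ expR (- c * t))).
  by apply: ge0_ler_powR => //; rewrite ?nnegrE ?expR_ge0.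
by apply: ler1_powR => //; exact: theta_le1.
Qed.

Lemma weight_ge0 g t z : 0 <= weight g t z.
Proof. by rewrite mulr_ge0 ?powR_ge0 ?expR_ge0. Qed.

Lemma weight_le g t z B K : 1 <= B -> 0 <= t -> 0 <= g <= B -> `|z| <= K ->
  weight g t z <= B * expR K.
Proof.
move=> B1 t0 gB zK; apply: ler_pM; rewrite ?powR_ge0 ?expR_ge0//.
  exact: powR_theta_le.
by rewrite ler_expR (le_trans (ler_norm _)).
Qed.

(** [g / B <= 1] can only grow when raised to a power at most 1. *)
Lemma ge_weight g t z B K : 1 <= B -> 0 <= t -> 0 <= g <= B -> `|z| <= K ->
  expR (- K) / B * g <= weight g t z.
Proof.
move=> B1 t0 /andP[g0 gB] zK; have B0 : 0 < B by rewrite (lt_le_trans _ B1).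
rewrite -mulrA mulrC /weight; apply: ler_pM => //.
- by rewrite mulr_ge0 ?invr_ge0 ?(ltW B0).
- move: g0; rewrite le_eqVlt => /predU1P[<-|g0].
    by rewrite mulr0 powR_ge0.
  have gB1 : 0 < B^-1 * g <= 1.
    by rewrite mulr_gt0 ?invr_gt0//= mulrC ler_pdivrMr// mul1r.
  apply: le_trans (ger1_powR gB1 (theta_le1 t0)) _.
  apply: ge0_ler_powR; rewrite ?nnegrE ?expR_ge0 ?(ltW g0)//.
    by case/andP : gB1 => /ltW.
  by rewrite ler_piMl ?(ltW g0)// invf_le1.
- by rewrite ler_expR; move: zK; rewrite ler_norml => /andP[].
Qed.

Lemma ge_weight_lb (r : R) g t z K : 0 < r <= 1 -> r <= g -> 0 <= t -> `|z| <= K ->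
  r * expR (- K) <= weight g t z.
Proof.
move=> r01 rg t0 zK; have /andP[r0 _] := r01.
apply: ler_pM => //; rewrite ?(ltW r0) ?expR_ge0//.
  apply: le_trans (ger1_powR r01 (theta_le1 t0)) _.
  by apply: ge0_ler_powR; rewrite ?nnegrE ?expR_ge0 ?(ltW r0) ?(le_trans (ltW r0)).
by rewrite ler_expR; move: zK; rewrite ler_norml => /andP[].
Qed.

Lemma expR_lipschitz (x y K : R) : x <= K -> y <= K ->
  `|expR x - expR y| <= expR K * `|x - y|.
Proof.
wlog yx : x y / y <= x => [h xK yK|xK yK].
  have [yx|/ltW xy] := leP y x; first exact: h.
  by rewrite distrC (distrC x); exact: h.
rewrite (ger0_norm (x := x - y)) ?subr_ge0//.
apply: (@mean_value_le _ expR expR) => //.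
- exact/continuous_subspaceT/continuous_expR.
- move=> u /andP[_ ux]; rewrite ger0_norm ?expR_ge0// ler_expR.
  exact: le_trans (ltW ux) xK.
Qed.

Lemma weight_lipschitz_exponent g t z z' B K : 1 <= B -> 0 <= t -> 0 <= g <= B ->
  `|z| <= K -> `|z'| <= K ->
  `|weight g t z - weight g t z'| <= B * expR K * `|z - z'|.
Proof.
move=> B1 t0 gB zK z'K; rewrite /weight -mulrBr normrM ger0_norm ?powR_ge0//.
rewrite -mulrA; apply: ler_pM; rewrite ?powR_ge0 ?normr_ge0//.
  exact: powR_theta_le.
by apply: expR_lipschitz; rewrite (le_trans (ler_norm _)).
Qed.

(** The birth-death equation without its entropy term. As [ln 0 = 0], it also
    holds where [g = 0], the weight being then 0 at all times. *)
Lemma is_derive_weight g (z : R -> R) t a : 0 <= g ->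
  is_derive t 1 z (- a - c * z t) ->
  is_derive t 1 (fun s => weight g s (z s))
    (- (weight g t (z t) * (a + c * ln (weight g t (z t))))).
Proof.
move=> g0 dz; have [g00|gn0] := eqVneq g 0.
  have w0 s : weight g s (z s) = 0 by rewrite /weight g00 powR0 ?mul0r// gt_eqF ?expR_gt0.
  rewrite (_ : (fun s => weight g s (z s)) = cst 0); last exact/funext.
  by apply: (is_derive_eq (is_derive_cst _ _ _)); rewrite w0 mul0r oppr0.
have wE s y : weight g s y = expR (ln g * expR (- c * s) + y).
  by rewrite /weight /powR (negbTE gn0) expRD (mulrC (ln g)).
rewrite (_ : (fun s => _) = expR \o (fun s => ln g * expR (- c * s) + z s)); last first.
  by apply/funext => s; rewrite wE.
have d1 := is_deriveD (is_deriveZ (ln g) (is_derive_expRM (- c) t)) dz.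
apply: (is_derive_eq (is_derive1_comp (is_derive_expR _) d1)).
rewrite !wE expRK /GRing.scale /=; ring.
Qed.

(** The time derivative of [p = g ^ expR (- c * t)] is [- c * p * ln p], and
    [p * ln p] is bounded for [p] in [[0, B]] although [ln g] is not bounded
    below: this gives a Lipschitz constant uniform in [g]. *)
Lemma weight_lipschitz_time g s t z B K : 1 <= B -> 0 <= s <= t -> 0 <= g <= B ->
  `|z| <= K -> `|weight g t z - weight g s z| <= c * B ^+ 2 * expR K * (t - s).
Proof.
move=> B1 /andP[s0 st] gB zK; have /andP[g0 _] := gB.
rewrite /weight -mulrBl normrM (ger0_norm (expR_ge0 _)) mulrAC.
apply: ler_pM; rewrite ?expR_ge0//; last by rewrite ler_expR (le_trans (ler_norm _)).
pose p (u : R) := weight g u 0.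
have pE u : g `^ expR (- c * u) = p u by rewrite /p /weight expR0 mulr1.
have dp (u : R) : is_derive u 1 p (- (p u * (0 + c * ln (p u)))).
  apply: (@is_derive_weight g (cst 0)) => //.
  by apply: (is_derive_eq (is_derive_cst _ _ _)); rewrite mulr0 !oppr0 addr0.
rewrite !pE.
apply: (@mean_value_le _ p (fun u : R => - (p u * (0 + c * ln (p u))))) => //.
  by apply: derivable_within_continuous => u _; have [] := dp u.
move=> u /andP[su _]; rewrite normrN add0r mulrCA normrM gtr0_norm// ler_pM2l//.
apply: normr_mul_ln_le => //; rewrite -pE powR_ge0/= powR_theta_le//.
exact: le_trans (ltW su).
Qed.

Lemma measurable_weight {disp} {T : measurableType disp} (g z : T -> R) t :
  measurable_fun setT g -> measurable_fun setT z ->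
  measurable_fun setT (fun x => weight (g x) t (z x)).
Proof.
move=> mg mz; apply: measurable_funM.
  by apply: (measurableT_comp (measurable_powR _)).
exact: measurableT_comp.
Qed.

End weight.

(** * Relative entropy and existence *)

Section relative_entropy.
Variables (R : realType) (d : nat) (pi : density R d).
Hypothesis pi_gt0 : forall x, 0 < pi x.
Local Notation mu := (lebesgue_rV R d).

Lemma measurable_density_ratio (m : density R d) :
  measurable_fun setT (fun x => m x / pi x).
Proof.
rewrite (_ : (fun x => _) = (fun x => m x * pi x `^ (-1))); last first.
  by apply/funext => x; rewrite powR_inv1// pdf_ge0.
apply: measurable_funM; first exact: measurable_pdf.
apply: (measurableT_comp (measurable_powR _)); exact: measurable_pdf.
Qed.

Lemma integrable_entropy (m : density R d) (M : R) : 1 <= M ->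
  (forall x, m x / pi x <= M) ->
  mu.-integrable setT (EFin \o (fun x => ln (m x / pi x) * m x)).
Proof.
move=> M1 mM; have mm := @measurable_pdf _ _ m; have mpi := @measurable_pdf _ _ pi.
apply: (@integrable_le_pdf _ _ pi _ (M ^+ 2)).
  apply: measurable_funM => //; apply: measurableT_comp => //.
  exact: measurable_density_ratio.
move=> x; have p0 := pi_gt0 x.
rewrite -[X in _ * X](divfK (lt0r_neq0 p0)) mulrA normrM (gtr0_norm p0).
rewrite ler_pM2r// mulrC; apply: normr_mul_ln_le => //.
by rewrite mM andbT; apply: divr_ge0; exact: pdf_ge0.
Qed.

Lemma dominates_le_pdf (m : density R d) (M : R) :
  (forall x, m x / pi x <= M) -> density_prob m `<< density_prob pi.
Proof.
move=> mM; apply/null_content_dominatesP => A mA pA0.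
have mMpi x : m x <= M * pi x by rewrite -ler_pdivrMr.
apply/eqP; rewrite eq_le measure_ge0 andbT.
have M0 : 0 <= M by apply: le_trans (mM 0); apply: divr_ge0; exact: pdf_ge0.
apply: (@le_trans _ _ (\int[mu]_(x in A) (M%:E * (pi x)%:E))%E).
  apply: ge0_le_integral_nonmeasurable => x _; first by rewrite lee_fin pdf_ge0.
  by rewrite -EFinM lee_fin.
rewrite ge0_integralZl//; last first.
- by move=> x _; rewrite lee_fin ltW.
- by apply: measurable_funTS; apply/measurable_EFinP; exact: measurable_pdf.
have pA : (\int[mu]_(x in A) (pi x)%:E = 0)%E by exact: pA0.
by rewrite pA mule0.
Qed.

Lemma KLE (m : density R d) (M : R) : 1 <= M -> (forall x, m x / pi x <= M) ->
  KL m pi = (\int[mu]_x (ln (m x / pi x) * m x))%:E.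
Proof.
move=> M1 mM; rewrite /KL asboolT; last exact: dominates_le_pdf mM.
rewrite /Rintegral fineK//; apply: integrable_fin_num => //.
exact: integrable_entropy mM.
Qed.

(** The average of [ln (m / pi)] is at most its upper bound. *)
Lemma KL_le_ln (m : density R d) (M : R) : 1 <= M -> (forall x, m x / pi x <= M) ->
  (KL m pi <= (ln M)%:E)%E.
Proof.
move=> M1 mM; rewrite (KLE M1 mM) lee_fin.
have M0 : 0 < M by rewrite (lt_le_trans _ M1).
have -> : ln M = \int[mu]_x (ln M * m x).
  by rewrite RintegralZl// ?Rintegral_pdf ?mulr1//; exact: integrable_pdf.
apply: le_Rintegral => //; first exact: integrable_entropy mM.
  by apply: integrable_EFinZ; exact: integrable_pdf.
move=> x _; have := pdf_ge0 m x; rewrite le_eqVlt => /predU1P[<-|m0].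
  by rewrite !mulr0.
by rewrite ler_pM2r// ler_ln ?posrE ?divr_gt0.
Qed.

End relative_entropy.

Section existence.
Variables (R : realType) (d : nat).
Local Notation P := (probability (Rd R d) R).
Local Notation mu := (lebesgue_rV R d).
Variables (dF : P -> Rd R d -> R) (pi m0 : density R d) (c C C2 B : R).
Hypotheses (c0 : 0 < c) (C0 : 0 <= C) (C20 : 0 <= C2) (B1 : 1 <= B).
Hypothesis pi_gt0 : forall x, 0 < pi x.
Hypothesis mdF : forall m, measurable_fun setT (dF m).
Hypothesis dFC : forall m x, `|dF m x| <= C.
Hypothesis dF_tv : forall (m m' : density R d) x,
  `|dF (density_prob m') x - dF (density_prob m) x|
    <= C2 * \int[mu]_x `|m' x - m x|.
Hypothesis dF_mean : forall m : density R d,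
  \int[mu]_x (dF (density_prob m) x * m x) = 0.
Hypothesis m0B : forall x, m0 x / pi x <= B.

Let B0 : 0 < B. Proof. exact: lt_le_trans B1. Qed.
Let g x := m0 x / pi x.
Let K := C / c.
Let U := B * expR K.

Let K0 : 0 <= K. Proof. by rewrite divr_ge0// ltW. Qed.

Let gB x : 0 <= g x <= B.
Proof. by rewrite m0B andbT; apply: divr_ge0; exact: pdf_ge0. Qed.

Let mg : measurable_fun setT g.
Proof.
exact: measurable_density_ratio.
Qed.

Let U1 : 1 <= U.
Proof. by rewrite -[leLHS]mulr1 ler_pM// -expR0 ler_expR. Qed.

Let U0 : 0 <= U. Proof. by rewrite (le_trans _ U1). Qed.

Definition gibbs_weight (t : R) (z : Rd R d -> R) x := weight c (m0 x / pi x) t (z x).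
Local Notation w := gibbs_weight.

Definition bounded_potential (z : Rd R d -> R) :=
  measurable_fun setT z /\ forall x, `|z x| <= K.
Local Notation bp := bounded_potential.

Let w_bounds t z : 0 <= t -> bp z -> forall x, 0 <= w t z x <= U.
Proof. move=> t0 [_ zK] x; rewrite weight_ge0 /=.
exact: (weight_le c0 B1 t0 (gB x) (zK x)). Qed.

Let w_norm t z : 0 <= t -> bp z -> forall x, `|w t z x| <= U.
Proof. by move=> t0 zb x; have /andP[? ?] := w_bounds t0 zb x; rewrite ger0_norm. Qed.

Let mw t z : bp z -> measurable_fun setT (w t z).
Proof. by move=> [mz _]; exact: measurable_weight. Qed.

(** The initial density [m0] itself has mass 1, and the weight dominates a
    multiple of [m0 / pi]. *)
Let Z_ge t z : 0 <= t -> bp z -> expR (- K) / B <= partition pi (w t z).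
Proof.
move=> t0 zb; have [mz zK] := zb.
have -> : expR (- K) / B = \int[mu]_x (expR (- K) / B * m0 x).
  by rewrite RintegralZl// ?Rintegral_pdf ?mulr1//; exact: integrable_pdf.
apply: le_Rintegral => //.
- by apply: integrable_EFinZ; exact: integrable_pdf.
- exact: (integrable_mul_pdf pi (mw t zb) (w_norm t0 zb)).
move=> x _; rewrite -[X in _ * X <= _](divfK (lt0r_neq0 (pi_gt0 x))) mulrA.
by rewrite ler_pM2r//; exact: (ge_weight c0 B1 t0 (gB x) (zK x)).
Qed.

Let Zmin_gt0 : 0 < expR (- K) / B.
Proof. by rewrite divr_gt0 ?expR_gt0. Qed.

Let Z_gt0 t z : 0 <= t -> bp z -> 0 < partition pi (w t z).
Proof. by move=> t0 zb; exact: lt_le_trans (Z_ge t0 zb). Qed.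

Let Z_le t z : 0 <= t -> bp z -> partition pi (w t z) <= U.
Proof.
move=> t0 zb.
have -> : U = partition pi (cst U).
  by rewrite /partition RintegralZl// ?Rintegral_pdf ?mulr1//; exact: integrable_pdf.
apply: (@le_partition _ _ pi _ _ U) => //.
- exact: mw.
- exact: w_norm.
- by move=> x /=; rewrite ger0_norm// (le_trans _ U1).
- by move=> x; case/andP : (w_bounds t0 zb x).
Qed.

Let gibbs_wE t z : 0 <= t -> bp z ->
  forall x, gibbs pi (w t z) x = w t z x * pi x / partition pi (w t z).
Proof. by move=> t0 zb; exact: (gibbsE (mw t zb) (w_bounds t0 zb) (Z_gt0 t0 zb)). Qed.

Let tv_w t z s y dlt : 0 <= t -> bp z -> 0 <= s -> bp y ->
  (forall x, `|w t z x - w s y x| <= dlt) ->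
  forall x, `|dF (density_prob (gibbs pi (w t z))) x -
              dF (density_prob (gibbs pi (w s y))) x|
    <= C2 * (2 * dlt / (expR (- K) / B)).
Proof.
move=> t0 zb s0 yb wd x; apply: (le_trans (dF_tv _ _ x)); rewrite ler_wpM2l//.
have d0 : 0 <= dlt by exact: le_trans (wd x).
apply: (le_trans (gibbs_tv (mw t zb) (mw s yb) (w_bounds t0 zb) (w_bounds s0 yb)
  (Z_gt0 t0 zb) (Z_gt0 s0 yb) wd)).
by rewrite ler_pM ?mulr_ge0 ?invr_ge0 ?(ltW (Z_gt0 _ _))// lef_pV2 ?posrE// ?Z_ge// Z_gt0.
Qed.

Let Phi (z : R -> Rd R d -> R) (t : R) x := dF (density_prob (gibbs pi (w t (z t)))) x.

Let Lip := c * B ^+ 2 * expR K + U * (C + C).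

Let adm_bp z t : 0 <= t -> admissible c C z -> bp (z t).
Proof.
move=> t0 az; split; first exact: adm_measurable az _ t0.
by move=> x; exact: adm_bounded az _ _ t0.
Qed.

Let w_lipschitz z s t x : admissible c C z -> 0 <= s <= t ->
  `|w t (z t) x - w s (z s) x| <= Lip * (t - s).
Proof.
move=> az /andP[s0 st]; have t0 := le_trans s0 st.
have [_ zt] := adm_bp t0 az; have [_ zs] := adm_bp s0 az.
rewrite -(subrKA (w s (z t) x)) (le_trans (ler_normD _ _))// mulrDl.
apply: lerD.
  by apply: (weight_lipschitz_time c0 B1 _ (gB x) (zt x)); rewrite s0.
rewrite -mulrA.
apply: (le_trans (weight_lipschitz_exponent c0 B1 s0 (gB x) (zt x) (zs x))).
by rewrite ler_wpM2l ?mulr_ge0 ?expR_ge0 ?(ltW B0)// (adm_lipschitz az)// s0.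
Qed.

(** The fixed point: [Phi z] is the drift along the path of Gibbs densities
    defined by [z], and [z] is in turn driven by this drift. *)
Lemma gibbs_path_exists : exists z : R -> Rd R d -> R, admissible c C z /\
  forall (t : R) x, 0 <= t -> is_derive t 1 (z ^~ x) (- Phi z t x - c * z t x).
Proof.
apply: (@picard _ _ _ c C (C2 * (2 * Lip / (expR (- K) / B)))
   (C2 * (2 * U / (expR (- K) / B)))) => //.
- apply: mulr_ge0 => //; apply: divr_ge0; last exact: ltW.
  by apply: mulr_ge0.
- by move=> z az t _; exact: mdF.
- by move=> z az t x _; exact: dFC.
- move=> z az s t x /[dup] st /andP[s0 st'].
  have t0 := le_trans s0 st'.
  have Lip_st y := @w_lipschitz z s t y az st.
  have := @tv_w _ _ _ _ _ t0 (adm_bp t0 az) s0 (adm_bp s0 az) Lip_st x.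
  by congr (_ <= _); ring.
- move=> z z' az az' t t0 dlt zz' x.
  have [_ zt] := adm_bp t0 az; have [_ zt'] := adm_bp t0 az'.
  have h y : `|w t (z t) y - w t (z' t) y| <= U * dlt.
    apply: (le_trans (weight_lipschitz_exponent c0 B1 t0 (gB y) (zt y) (zt' y))).
    by rewrite ler_wpM2l.
  have := @tv_w _ _ _ _ _ t0 (adm_bp t0 az) t0 (adm_bp t0 az') h x.
  by congr (_ <= _); ring.
Qed.
(** The integral of the unnormalized equation, in which the drift [dF] drops out
    because its average under [gibbs pi (w t (z t))] is 0. *)
Let partition_derive z (t : R) : admissible c C z ->
  (forall (t : R) x, 0 <= t -> is_derive t 1 (z ^~ x) (- Phi z t x - c * z t x)) ->
  0 <= t ->
  has_derivative_within [set s | 0 <= s] (fun s => partition pi (w s (z s))) t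
    (- (c * partition pi (w t (z t)) *
        \int[mu]_x (ln (w t (z t) x) * gibbs pi (w t (z t)) x))).
Proof.
move=> az dz t0; have zb := adm_bp t0 az.
pose u := w t (z t); pose Z := partition pi u; pose m := gibbs pi u.
have Z0 : 0 < Z by exact: Z_gt0.
have mE x : m x = u x * pi x / Z by exact: gibbs_wE.
have u_ge0 x : 0 <= u x by exact: weight_ge0.
have uU x : u x <= U by have /andP[] := w_bounds t0 zb x.
have mu_ : measurable_fun setT u by exact: mw.
have mpi := @measurable_pdf _ _ pi.
pose a := Phi z t.
have ma : measurable_fun setT a by exact: mdF.
pose W x := - (u x * (a x + c * ln (u x))) * pi x.
have mlnu : measurable_fun setT (fun x => ln (u x)) by exact: measurableT_comp.
have mW : measurable_fun setT W.
  apply: measurable_funM => //; apply: measurable_funN.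
  by apply: measurable_funM => //; apply: measurable_funD => //; exact: measurable_funM.
have ulnu x : `|u x * ln (u x)| <= U ^+ 2.
  by apply: normr_mul_ln_le => //; rewrite u_ge0 uU.
(* [Lip] controls the difference quotients, the other terms their limit [W]. *)
pose G0 := Lip + (U * C + c * U ^+ 2).
have Lip0 : 0 <= Lip.
  by rewrite /Lip addr_ge0 ?mulr_ge0 ?exprn_ge0 ?expR_ge0 ?(ltW B0) ?(ltW c0)// addr_ge0.
have WG x : `|W x| <= G0 * pi x.
  rewrite /W normrM (gtr0_norm (pi_gt0 x)) ler_pM2r// normrN mulrDr.
  apply: (le_trans (ler_normD _ _)); rewrite /G0 -[leLHS]add0r lerD// lerD//.
    rewrite normrM (ger0_norm (u_ge0 x)); apply: ler_pM => //.
    exact: dFC.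
  by rewrite mulrCA normrM gtr0_norm// ler_pM2l.
have -> : - (c * Z * \int[mu]_x (ln (u x) * m x)) = \int[mu]_x W x.
  have lnmi : mu.-integrable setT (EFin \o (fun x => ln (u x) * m x)).
    apply: (@integrable_le_pdf _ _ pi _ (U ^+ 2 / Z)).
      by apply: measurable_funM => //; exact: measurable_pdf.
    move=> x; have -> : ln (u x) * m x = u x * ln (u x) / Z * pi x by rewrite mE; ring.
    rewrite normrM (gtr0_norm (pi_gt0 x)) ler_pM2r// normrM.
    by rewrite (gtr0_norm (x := Z^-1)) ?invr_gt0// ler_pM2r ?invr_gt0.
  have ami : mu.-integrable setT (EFin \o (fun x => a x * m x)).
    apply: (@integrable_le_pdf _ _ m _ C).
      by apply: measurable_funM => //; exact: measurable_pdf.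
    move=> x; rewrite normrM (ger0_norm (pdf_ge0 m x)) ler_wpM2r ?pdf_ge0//.
    exact: dFC.
  have WE x : W x = - Z * (a x * m x + c * (ln (u x) * m x)).
    by rewrite mE /W; field; rewrite gt_eqF.
  rewrite [RHS](_ : _ =
    \int[mu]_x (- Z * (a x * m x + c * (ln (u x) * m x)))); last first.
    by apply: eq_Rintegral => x _; rewrite WE.
  have clnmi : mu.-integrable setT (EFin \o (fun x => c * (ln (u x) * m x))).
    exact: integrable_EFinZ.
  rewrite RintegralZl//; last exact: integrable_EFinD.
  rewrite RintegralD// RintegralZl// dF_mean; ring.
apply: (@has_derivative_within_integral _ _ _ mu _ (fun s x => w s (z s) x * pi x) W
   (fun x => G0 * pi x)) => //.
- move=> s s0; have zs := adm_bp s0 az.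
  exact: (integrable_mul_pdf pi (mw s zs) (w_norm s0 zs)).
- by apply: integrable_EFinZ; exact: integrable_pdf.
- move=> s x s0; rewrite -mulrBl normrM (gtr0_norm (pi_gt0 x)) mulrAC ler_pM2r//.
  have LG : Lip <= G0.
    rewrite lerDl; apply: addr_ge0; apply: mulr_ge0 => //; rewrite ?(ltW c0)//.
    exact: sqr_ge0.
  apply: (@le_trans _ _ (Lip * `|s - t|)); last by rewrite ler_wpM2r.
  have [ts|/ltW st] := leP t s.
    by rewrite (ger0_norm (x := s - t)) ?subr_ge0//; apply: w_lipschitz => //; rewrite t0.
  rewrite distrC (distrC s) (ger0_norm (x := t - s)) ?subr_ge0//.
  by apply: w_lipschitz => //; rewrite s0.
- move=> x; apply: is_derive_within.
  have /andP[gx0 _] := gB x.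
  have du := is_derive_weight gx0 (dz t x t0).
  apply: (is_derive_eq (is_deriveM du (is_derive_cst (pi x) t 1))).
  by rewrite /GRing.scale /= mulr0 add0r mulrC.
Qed.

(** Dividing [u_t * pi] by [Z_t] adds [- Z' / Z] to the logarithmic derivative.
    This equals [c] times the average of [ln u_t], that is
    [c * (KL (m t) pi + ln Z_t)], and [ln Z_t] is absorbed in
    [ln u_t = ln (m_t / pi) + ln Z_t]. *)
Lemma birth_death_path_exists : exists m : R -> density R d,
  [/\ forall x, m 0 x = m0 x,
      forall t x, 0 <= t ->
        has_derivative_within [set s | 0 <= s] (fun s => m s x) t
          (- (dF (density_prob (m t)) x + c * ln (m t x / pi x)
              - c * fine (KL (m t) pi)) * m t x),
      forall t x, 0 <= t -> m t x / pi x <= B ^+ 2 * expR (2 * K) &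
      forall r, 0 < r <= 1 -> (forall x, r <= m0 x / pi x) ->
        forall t x, 0 <= t -> r * expR (- K) / (B * expR K) <= m t x / pi x].
Proof.
have [z [az dz]] := gibbs_path_exists.
pose m t := gibbs pi (w t (z t)).
have zb t (t0 : 0 <= t) : bp (z t) by exact: adm_bp.
have mE t x (t0 : 0 <= t) : m t x = w t (z t) x * pi x / partition pi (w t (z t)).
  exact: gibbs_wE t0 (zb t t0) x.
have ratioE t x (t0 : 0 <= t) : m t x / pi x = w t (z t) x / partition pi (w t (z t)).
  by rewrite mE// mulrAC mulfK// gt_eqF.
have upper t x (t0 : 0 <= t) : m t x / pi x <= B ^+ 2 * expR (2 * K).
  have zt := zb t t0; have Z0 := Z_gt0 t0 zt.
  rewrite ratioE//; have /andP[u0 uU] := w_bounds t0 zt x.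
  have -> : B ^+ 2 * expR (2 * K) = U * (expR (- K) / B)^-1.
    rewrite /U invf_div expRN invrK (_ : 2 * K = K + K) ?expRD; ring.
  by apply: ler_pM => //; rewrite ?invr_ge0 ?(ltW Z0)// lef_pV2 ?posrE// Z_ge.
exists m; split => //.
- move=> x; have w0E y : w 0 (z 0) y = m0 y / pi y.
    rewrite /w /weight mulr0 expR0 powRr1; last by case/andP : (gB y).
    by rewrite (adm0 az) expR0 mulr1.
  rewrite mE// w0E divfK ?gt_eqF//.
  rewrite (_ : partition _ _ = 1) ?divr1// -[RHS](Rintegral_pdf m0).
  by apply: eq_Rintegral => y _; rewrite w0E divfK// gt_eqF.
- move=> t x t0.
  pose u := w t (z t); pose Z := partition pi u.
  have Z0 : 0 < Z by apply: Z_gt0 => //; exact: zb.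
  pose E := \int[mu]_x (ln (u x) * m t x).
  have dZ : has_derivative_within [set s | 0 <= s] _ t (- (c * Z * E)) :=
    partition_derive az dz t0.
  have /andP[gx0 _] := gB x.
  have du := is_derive_weight gx0 (dz t x t0).
  have dupi := is_derive_within [set s | 0 <= s]
    (is_deriveM du (is_derive_cst (pi x) t 1)).
  have Zn0 : Z != 0 by rewrite gt_eqF.
  have := has_derivative_within_div Zn0 dupi dZ.
  have M1 : 1 <= B ^+ 2 * expR (2 * K).
    rewrite -[leLHS]mulr1 ler_pM// ?exprn_ege1// -expR0 ler_expR mulr_ge0//.
  rewrite (KLE pi_gt0 M1 (fun y => upper t y t0)) /=.
  have ln_ratio y : 0 < u y -> ln (m t y / pi y) = ln (u y) - ln Z.
    by move=> uy; rewrite ratioE// ln_div.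
  have u0 y : 0 <= u y by exact: weight_ge0.
  have EE : E = \int[mu]_y (ln (m t y / pi y) * m t y) + ln Z.
    rewrite -[X in _ = _ + X]mulr1 -[X in _ = _ + _ * X](Rintegral_pdf (m t)).
    rewrite -RintegralZl//; last exact: integrable_pdf.
    have i1 := integrable_entropy pi_gt0 M1 (fun y => upper t y t0).
    have i2 := integrable_EFinZ (ln Z) (integrable_pdf (m t)).
    rewrite -RintegralD//.
    apply: eq_Rintegral => y _; have := u0 y; rewrite le_eqVlt => /predU1P[uy|uy].
      by rewrite (mE t y t0) -/u -uy mul0r mul0r !mulr0 addr0.
    by rewrite ln_ratio// -mulrDl subrK.
  move=> /(has_derivative_within_eq (D := [set s | 0 <= s]) t0); apply.
    by move=> s s0; rewrite (mE s x s0).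
  rewrite (_ : \int[mu]_y _ = E - ln Z); last by rewrite EE addrK.
  rewrite [X in _ = _ * X](mE t x t0) -/u -/Z /GRing.scale /= mulr0 add0r.
  rewrite -[(_ * cst (pi x)) t]/(u x * pi x) -[weight c (g x) t (z t x)]/(u x).
  rewrite -[dF (density_prob (m t)) x]/(Phi z t x).
  have := u0 x; rewrite le_eqVlt => /predU1P[ux|ux].
    by rewrite -ux !(mul0r, mulr0, oppr0, subr0).
  by rewrite ln_ratio//; field.
- move=> r r01 rg t x t0; have zt := zb t t0; have Z0 := Z_gt0 t0 zt.
  rewrite ratioE//; apply: ler_pM.
  + by case/andP : r01 => r0 _; rewrite mulr_ge0 ?expR_ge0 ?ltW.
  + by rewrite invr_ge0 mulr_ge0 ?expR_ge0 ?ltW.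
  + by have [_ zK] := zt; exact: (ge_weight_lb c0 r01 (rg x) t0 (zK x)).
  + by rewrite lef_pV2 ?posrE ?Z_le// (lt_le_trans _ U1).
Qed.

End existence.

(** * Uniqueness *)

Lemma density_pos_exists (R : realType) (d : nat) (m : density R d) : exists x, 0 < m x.
Proof.
apply: contrapT => h; have m0 x : m x = 0.
  apply/eqP; rewrite eq_le pdf_ge0 andbT leNgt; apply/negP => mx.
  by apply: h; exists x.
have := Rintegral_pdf m; rewrite (_ : (fun x => m x) = cst 0); last exact/funext.
by rewrite /Rintegral integral0 /= => /esym/eqP; rewrite oner_eq0.
Qed.

(** Otherwise [ln p - ln q] would be at least some [e > 0] everywhere on the
    common support, whence [q <= expR (- e) * p], which is impossible for two
    functions of integral 1. *)
Lemma log_ratio_le (R : realType) (d : nat) (p q : density R d) (dlt : R) :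
  (forall x, (0 < p x) = (0 < q x)) ->
  (forall x y, 0 < p x -> 0 < p y ->
    `|ln (p x) - ln (q x) - (ln (p y) - ln (q y))| <= dlt) ->
  forall x, 0 < p x -> ln (p x) - ln (q x) <= dlt.
Proof.
move=> pq0 pqd x px; rewrite leNgt; apply/negP => dx.
pose e := ln (p x) - ln (q x) - dlt.
have e0 : 0 < e by rewrite subr_gt0.
have qp y : q y <= expR (- e) * p y.
  have [py|] := boolP (0 < p y); last first.
    move=> py; have qy := py; rewrite pq0 in qy.
    have -> : q y = 0 by apply/eqP; rewrite eq_le pdf_ge0 andbT leNgt.
    by rewrite mulr_ge0 ?expR_ge0 ?pdf_ge0.
  have qy : 0 < q y by rewrite -pq0.
  have py' : expR (ln (p y)) = p y by rewrite lnK.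
  have qy' : expR (ln (q y)) = q y by rewrite lnK.
  rewrite -[leLHS]qy' -[X in _ * X]py' -expRD ler_expR /e.
  by have := pqd x y px py; rewrite ler_norml => /andP[_]; lra.
have : 1 <= expR (- e) * 1.
  rewrite -{1}(Rintegral_pdf q) -(Rintegral_pdf p) -RintegralZl//; last first.
    exact: integrable_pdf.
  apply: le_Rintegral => //; first exact: integrable_pdf.
  by apply: integrable_EFinZ; exact: integrable_pdf.
by rewrite mulr1 -expR0 ler_expR oppr_ge0 leNgt e0.
Qed.

Lemma log_ratio_norm_le (R : realType) (d : nat) (p q : density R d) (dlt : R) :
  (forall x, (0 < p x) = (0 < q x)) ->
  (forall x y, 0 < p x -> 0 < p y ->
    `|ln (p x) - ln (q x) - (ln (p y) - ln (q y))| <= dlt) ->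
  forall x, 0 < p x -> `|ln (p x) - ln (q x)| <= dlt.
Proof.
move=> pq0 pqd x px; rewrite ler_norml (log_ratio_le pq0 pqd)// andbT.
rewrite lerNl opprB; apply: (@log_ratio_le _ _ q p) => [y|y z qy qz|]; rewrite ?pq0//.
  rewrite -normrN; have := pqd y z; rewrite !pq0 => /(_ qy qz).
  by congr (`| _ | <= _); ring.
by rewrite -pq0.
Qed.

(** [|p - q| <= max p q * |ln p - ln q| <= (p + q) * dlt]. *)
Lemma log_ratio_tv_le (R : realType) (d : nat) (p q : density R d) (dlt : R) :
  (forall x, (0 < p x) = (0 < q x)) ->
  (forall x y, 0 < p x -> 0 < p y ->
    `|ln (p x) - ln (q x) - (ln (p y) - ln (q y))| <= dlt) ->
  \int[lebesgue_rV R d]_x `|p x - q x| <= 2 * dlt.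
Proof.
move=> pq0 pqd.
have -> : 2 * dlt = \int[lebesgue_rV R d]_x (dlt * (p x + q x)).
  rewrite RintegralZl//; last by apply: integrable_EFinD; exact: integrable_pdf.
  by rewrite RintegralD// ?Rintegral_pdf; [ring|exact: integrable_pdf..].
apply: le_Rintegral => //.
- exact: integrable_dist_pdf.
- by apply: integrable_EFinZ; apply: integrable_EFinD; exact: integrable_pdf.
move=> x _; have [px|px] := boolP (0 < p x); last first.
  have qx := px; rewrite pq0 in qx.
  have -> : p x = 0 by apply/eqP; rewrite eq_le pdf_ge0 andbT leNgt.
  have -> : q x = 0 by apply/eqP; rewrite eq_le pdf_ge0 andbT leNgt.
  by rewrite subrr normr0 addr0 mulr0.
have qx : 0 < q x by rewrite -pq0.
have px' : expR (ln (p x)) = p x by rewrite lnK.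
have qx' : expR (ln (q x)) = q x by rewrite lnK.
have h := log_ratio_norm_le pq0 pqd px.
rewrite mulrC; apply: (@le_trans _ _
  (expR (Num.max (ln (p x)) (ln (q x))) * `|ln (p x) - ln (q x)|)).
  by rewrite -[in leLHS]px' -[in leLHS]qx' expR_lipschitz// le_max lexx ?orbT.
apply: ler_pM; rewrite ?expR_ge0//.
by case: (leP (ln (p x)) (ln (q x))) => _; rewrite ?px' ?qx' ?lerDl ?lerDr ltW.
Qed.

Section flow.
Variables (R : realType) (d : nat).
Local Notation P := (probability (Rd R d) R).
Local Notation mu := (lebesgue_rV R d).
Variables (dF : P -> Rd R d -> R) (pi : density R d) (c C : R).
Hypotheses (c0 : 0 < c).
Hypothesis pi_gt0 : forall x, 0 < pi x.
Hypothesis dFC : forall m x, `|dF m x| <= C.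

(** The entropy is replaced by an arbitrary function [k] of time. *)
Definition birth_death_flow (k : R -> R) (m : R -> density R d) :=
  forall t x, 0 <= t -> has_derivative_within [set s | 0 <= s] (fun s => m s x) t
    (- (dF (density_prob (m t)) x + c * ln (m t x / pi x) - c * k t) * m t x).

Variables (k : R -> R) (m : R -> density R d).
Hypothesis mflow : birth_death_flow k m.
Implicit Types (x y : Rd R d) (t s : R).

Let a t x := dF (density_prob (m t)) x.

Lemma flow_derive t x : 0 < t -> is_derive t 1 (fun s => m s x)
  (- (a t x + c * ln (m t x / pi x) - c * k t) * m t x).
Proof.
move=> t0; apply: within_is_derive (@mflow t x (ltW t0)).
apply: filterS (lt_nbhsr t0); first by move=> s /ltW.
Qed.

Lemma flow_cvg t x : 0 <= t -> m s x @[s --> within [set s | 0 <= s] (nbhs t)] --> m t x.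
Proof. by move=> t0; exact: has_derivative_within_cvg (@mflow t x t0). Qed.

(** Positivity propagates from [x] as long as some other point [y] stays charged:
    the ratio of the two values does not involve [k]. The affine time change
    covers both directions of time, with [e = 1] and [e = -1]. *)
Lemma flow_ratio_gt0 (p e T : R) x y : 0 <= T ->
  (forall s, 0 <= s <= T -> 0 <= p + e * s) ->
  (forall s, 0 < s < T -> 0 < p + e * s) ->
  (forall s, 0 <= s <= T -> 0 < m (p + e * s) y) ->
  0 < m p x -> 0 < m (p + e * T) x.
Proof.
move=> T0 tau0 tau_gt0 my mx.
pose q s := m (p + e * s) x / m (p + e * s) y.
pose L := ln (pi y) - ln (pi x).
pose b s := e * (- (a (p + e * s) x - a (p + e * s) y) - c * L).
have dtau (s : R) : is_derive s 1 (fun u : R => p + e * u) e.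
  apply: (is_derive_eq (is_deriveD (is_derive_cst p s 1)
    (is_deriveZ (f := id) e (is_derive_id s 1)))).
  by rewrite /GRing.scale /= mulr1 add0r.
suff : 0 < q T by rewrite /q pmulr_lgt0// invr_gt0 my// lexx T0.
apply: (@log_ode_gt0 _ q b (- (e * c)) (`|e| * (C + C + c * `|L|))) => //.
- apply/subspace_continuousP => s sT.
  have cv z : m (p + e * u) z @[u --> within `[0, T] (nbhs s)] --> m (p + e * s) z.
    have s0 : 0 <= p + e * s by apply: tau0; move: sT; rewrite /= in_itv.
    apply: (@cvg_comp _ _ _ (fun u => p + e * u) (fun v => m v z)); last exact: flow_cvg.
    move=> A hA.
    have h : \forall u \near s, 0 <= p + e * u -> A (p + e * u).
      exact: (is_derive_continuous (dtau s) hA).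
    apply: (@filterS _ (nbhs s) _ _ _ _ h) => u hu uT; apply: hu.
    by apply: tau0; move: uT; rewrite /= in_itv.
  apply: cvgM => //; apply: cvgV => //.
  by rewrite gt_eqF// my//; move: sT; rewrite /= in_itv.
- by move=> s _; rewrite divr_ge0 ?pdf_ge0.
- move=> s /andP[s0 sT]; rewrite /q => qs.
  have my' : 0 < m (p + e * s) y by rewrite my// !ltW.
  have ts : 0 < p + e * s by rewrite tau_gt0// s0.
  have mx' : 0 < m (p + e * s) x.
    by move: qs; rewrite pmulr_lgt0// invr_gt0.
  have dx := @is_derive1_comp _ (fun u => m u x) _ s _ _ (flow_derive x ts) (dtau s).
  have dy := @is_derive1_comp _ (fun u => m u y) _ s _ _ (flow_derive y ts) (dtau s).
  have dxy := has_derivative_within_div (lt0r_neq0 my') (is_derive_within setT dx)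
    (is_derive_within setT dy).
  apply/is_deriveP; apply: has_derivative_within_eq dxy _ => //.
  rewrite /= /b /L !ln_div ?posrE//; field.
  by rewrite gt_eqF.
- move=> s _; rewrite /b normrM ler_wpM2l//.
  apply: (le_trans (ler_normB _ _)); rewrite normrN normrM gtr0_norm// lerD2r.
  by apply: (le_trans (ler_normB _ _)); apply: lerD; exact: dFC.
- by rewrite /q mulr0 addr0 divr_gt0// -[p]addr0 -[X in p + X](mulr0 e) my// lexx.
Qed.

(** At a first time [r] with [m r x = 0] some point [y] is charged, since [m r] has
    mass 1; it is charged already slightly before [r], when [m x] is
    positive. *)
Lemma flow_gt0 t x : 0 <= t -> 0 < m 0 x -> 0 < m t x.
Proof.
move=> t0 mx; rewrite lt0r pdf_ge0 andbT; apply/eqP => mt0.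
have mc : {within `[0, t], continuous (fun s => m s x)}.
  apply/subspace_continuousP => s st; have s0 : 0 <= s.
    by move: st; rewrite /= in_itv /= => /andP[].
  move=> A hA; have h : \forall u \near s, 0 <= u -> A (m u x).
    exact: (@flow_cvg s x s0 A hA).
  apply: (@filterS _ (nbhs s) _ _ _ _ h) => u hu ut.
  by apply: hu; move: ut; rewrite /= in_itv /= => /andP[].
have [r [/andP[r0 rt] mr mpos]] := first_zero t0 mc (fun s _ => pdf_ge0 (m s) x) mx mt0.
have [y my] := density_pos_exists (m r).
have /nbhs_ballP[e /= e0 He] : \forall s \near r, 0 <= s -> 0 < m s y.
  exact: (@cvgr_gt _ _ _ (within_filter _ _) _ (m r y) (@flow_cvg r y (ltW r0)) _ my).
(* A nonnegative time before [r], close enough to [r] for [y] to be charged on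
   the whole of [[s, r]]. *)
pose s := Num.max 0 (r - e / 2).
have s0 : 0 <= s by rewrite le_max lexx.
have sr : s < r by rewrite gt_max r0 /= ltrBlDr ltrDl; lra.
have se : r - e < s by rewrite lt_max; apply/orP; right; lra.
have sE u : s + 1 * u = s + u by rewrite mul1r.
have := @flow_ratio_gt0 s 1 (r - s) x y; rewrite sE subrKC mr ltxx => h.
suff : false by []; apply: h.
- by rewrite subr_ge0 ltW.
- by move=> u /andP[u0 _]; rewrite sE addr_ge0.
- by move=> u /andP[u0 _]; rewrite sE ltr_wpDl.
- move=> u /andP[u0 ur]; rewrite sE; apply: He; last by rewrite addr_ge0.
  rewrite /ball /= ger0_norm; lra.
- by apply: mpos; rewrite s0 sr.
Qed.

Lemma flow_pos t x : 0 <= t -> (0 < m t x) = (0 < m 0 x).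
Proof.
move=> t0; apply/idP/idP; last exact: flow_gt0.
have [y my] := density_pos_exists (m 0).
have := @flow_ratio_gt0 t (-1) t x y t0; rewrite mulN1r subrr; apply.
- by move=> s /andP[_ st]; rewrite mulN1r subr_ge0.
- by move=> s /andP[_ st]; rewrite mulN1r subr_gt0.
- by move=> s /andP[_ st]; rewrite mulN1r flow_gt0// subr_ge0.
Qed.

Lemma flow_ln_derive t x : 0 < t -> 0 < m t x ->
  is_derive t 1 (fun s => ln (m s x))
    (- (a t x + c * (ln (m t x) - ln (pi x)) - c * k t)).
Proof.
move=> t0 mx.
apply: (is_derive_eq (is_derive1_comp (is_derive1_ln mx) (flow_derive x t0))).
by rewrite ln_div ?posrE//; field; rewrite gt_eqF.
Qed.

Lemma flow_ln_cvg t x : 0 <= t -> 0 < m t x ->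
  ln (m s x) @[s --> within [set s | 0 <= s] (nbhs t)] --> ln (m t x).
Proof.
by move=> t0 mx; apply: (@cvg_comp _ _ _ (fun s => m s x) (@ln R));
  [exact: flow_cvg|exact: continuous_ln].
Qed.

End flow.

Section uniqueness.
Variables (R : realType) (d : nat).
Local Notation P := (probability (Rd R d) R).
Local Notation mu := (lebesgue_rV R d).
Variables (dF : P -> Rd R d -> R) (pi : density R d) (c C C2 : R).
Hypotheses (c0 : 0 < c) (C0 : 0 <= C) (C20 : 0 <= C2).
Hypothesis pi_gt0 : forall x, 0 < pi x.
Hypothesis dFC : forall m x, `|dF m x| <= C.
Hypothesis dF_tv : forall (m m' : density R d) x,
  `|dF (density_prob m') x - dF (density_prob m) x|
    <= C2 * \int[mu]_x `|m' x - m x|.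

(** Let [D t x] be the difference of the logarithms. A bound
    [A * expR (lam * t)] on the forcing [b] of [D t x - D t y] bounds this
    difference by [A * expR (lam * t) / (lam + c)], hence the distance between
    the two densities, hence [b] again by half the initial bound as
    [lam = 8 * C2]. So [b] and [D t x - D t y] vanish, and so does [D] since both
    densities have mass 1. *)
Lemma flow_unique (k k' : R -> R) (m m' : R -> density R d) :
  birth_death_flow dF pi c k m -> birth_death_flow dF pi c k' m' ->
  (forall x, m' 0 x = m 0 x) -> forall t x, 0 <= t -> m' t x = m t x.
Proof.
move=> fm fm' m00.
have pos t x (t0 : 0 <= t) : (0 < m t x) = (0 < m 0 x).
  exact: (flow_pos c0 pi_gt0 dFC fm).
have pos' t x (t0 : 0 <= t) : (0 < m' t x) = (0 < m 0 x).
  by rewrite (flow_pos c0 pi_gt0 dFC fm')// m00.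
have pq0 t (t0 : 0 <= t) x : (0 < m t x) = (0 < m' t x) by rewrite pos// pos'.
pose D (t : R) x := ln (m t x) - ln (m' t x).
pose b (t : R) x y := (dF (density_prob (m t)) x - dF (density_prob (m' t)) x) -
  (dF (density_prob (m t)) y - dF (density_prob (m' t)) y).
pose lam := 8 * C2.
have lam0 : 0 <= lam by rewrite mulr_ge0.
have lc0 : 0 < lam + c by rewrite ltr_wpDl.
have DA (A : R) : 0 <= A ->
    (forall t x y, 0 <= t -> `|b t x y| <= A * expR (lam * t)) ->
    forall t x y, 0 <= t -> 0 < m 0 x -> 0 < m 0 y ->
    `|D t x - D t y| <= A * expR (lam * t) / (lam + c).
  move=> A0 bA t x y t0 mx my.
  apply: (@linear_ode_le _ c lam A (fun s => D s x - D s y) (fun s => b s x y)) => //.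
  - apply/subspace_continuousP => s s0.
    have {}s0 : 0 <= s by move: s0; rewrite /= in_itv /= andbT.
    have set_eq : `[0, +oo[%classic = [set s : R | 0 <= s].
      by apply/seteqP; split => u; rewrite /= in_itv /= andbT.
    rewrite set_eq.
    have cv z : 0 < m 0 z -> D s z @[s --> within [set s | 0 <= s] (nbhs s)] --> D s z.
      move=> mz; apply: cvgB; [apply: (flow_ln_cvg fm) => //; rewrite ?pos//|
        apply: (flow_ln_cvg fm') => //; rewrite ?pos'//].
    by apply: cvgB; exact: cv.
  - by rewrite /D !m00 !subrr.
  - move=> s s0.
    have dln z (mz : 0 < m 0 z) : is_derive s 1 (fun s => ln (m s z)) _ :=
      flow_ln_derive pi_gt0 fm s0 (etrans (pos s z (ltW s0)) mz).
    have dln' z (mz : 0 < m 0 z) : is_derive s 1 (fun s => ln (m' s z)) _ :=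
      flow_ln_derive pi_gt0 fm' s0 (etrans (pos' s z (ltW s0)) mz).
    apply: (is_derive_eq (is_deriveB (is_deriveB (dln x mx) (dln' x mx))
      (is_deriveB (dln y my) (dln' y my)))).
    rewrite /b /D; ring.
  - by move=> s s0; apply: bA; exact: ltW.
have bD (dlt : R) t : 0 <= t ->
    (forall x y, 0 < m 0 x -> 0 < m 0 y -> `|D t x - D t y| <= dlt) ->
    forall x y, `|b t x y| <= 4 * C2 * dlt.
  move=> t0 Dd x y.
  have tv : \int[mu]_x `|m t x - m' t x| <= 2 * dlt.
    apply: log_ratio_tv_le; first exact: pq0.
    by move=> z z'; rewrite !pos//; exact: Dd.
  have h z : `|dF (density_prob (m t)) z - dF (density_prob (m' t)) z| <= C2 * (2 * dlt).
    by apply: (le_trans (dF_tv _ _ z)); rewrite ler_wpM2l.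
  apply: (le_trans (ler_normB _ _)); apply: (le_trans (lerD (h x) (h y))).
  rewrite le_eqVlt; apply/orP; left; apply/eqP; ring.
have bn (n : nat) : forall t x y, 0 <= t ->
    `|b t x y| <= 4 * C * 2^-1 ^+ n * expR (lam * t).
  elim: n => [|n ih] t x y t0.
    apply: (@le_trans _ _ (4 * C)).
      have h z : `|dF (density_prob (m t)) z - dF (density_prob (m' t)) z| <= C + C.
        by apply: (le_trans (ler_normB _ _)); apply: lerD; exact: dFC.
      apply: (le_trans (ler_normB _ _)); apply: (le_trans (lerD (h x) (h y))).
      lra.
    rewrite expr0 mulr1 ler_peMr ?mulr_ge0// -expR0 ler_expR mulr_ge0//.
  have A0 : 0 <= 4 * C * 2^-1 ^+ n.
    by apply: mulr_ge0; [apply: mulr_ge0|rewrite exprn_ge0// invr_ge0].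
  have := @bD _ t t0 (fun x y => DA _ A0 ih t x y t0) x y.
  move=> /le_trans; apply.
  have -> : 4 * C2 * (4 * C * 2^-1 ^+ n * expR (lam * t) / (lam + c))
     = 4 * C * 2^-1 ^+ n * expR (lam * t) * (4 * C2 / (lam + c)) by ring.
  have -> : 4 * C * 2^-1 ^+ n.+1 * expR (lam * t)
     = 4 * C * 2^-1 ^+ n * expR (lam * t) * 2^-1 by rewrite exprSr; ring.
  apply: ler_wpM2l; first by apply: mulr_ge0 => //; exact: expR_ge0.
  rewrite ler_pdivrMr// (_ : 2^-1 * (lam + c) = 4 * C2 + c / 2).
    by rewrite lerDl divr_ge0// ltW.
  by rewrite /lam; field.
move=> t x t0.
have D0 y z : 0 < m 0 y -> 0 < m 0 z -> D t y - D t z = 0.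
  move=> my mz.
  apply: (@half_geometric_eq0 _ _ (4 * C * expR (lam * t) / (lam + c))) => n.
  have A0 : 0 <= 4 * C * 2^-1 ^+ n.
    by apply: mulr_ge0; [apply: mulr_ge0|rewrite exprn_ge0// invr_ge0].
  have := DA _ A0 (bn n) t y z t0 my mz; congr (_ <= _).
  ring.
have [mx|mx] := boolP (0 < m 0 x); last first.
  have m0 : m t x = 0 by apply/eqP; rewrite eq_le pdf_ge0 andbT leNgt pos.
  have m'0 : m' t x = 0 by apply/eqP; rewrite eq_le pdf_ge0 andbT leNgt pos'.
  by rewrite m0 m'0.
have : `|ln (m t x) - ln (m' t x)| <= 0.
  apply: (log_ratio_norm_le (pq0 t t0)); last by rewrite pos.
  by move=> y z; rewrite !pos// => my mz; rewrite -/(D t y) -/(D t z) D0// normr0.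
rewrite normr_le0 subr_eq0 => /eqP /ln_inj h; apply/esym/h.
  by rewrite posrE pos.
by rewrite posrE pos'.
Qed.

End uniqueness.

(** * The theorem *)

Theorem theorem2p1 (R : realType) (d : nat) (sigma : R) (hsigma : 0 < sigma)
  (F : probability (Rd R d) R -> R)
  (dF : probability (Rd R d) R -> Rd R d -> R)
  (d2F : probability (Rd R d) R -> Rd R d -> Rd R d -> R)
  (hdF : flat_derivative F dF)
  (hd2F : flat_derivative2 dF d2F)
  (hconvex : flat_convex F dF)
  (C : R) (hC : 0 < C) (hdFC : forall m x, `|dF m x| <= C)
  (C2 : R) (hC2 : 0 < C2) (hd2FC2 : forall m x y, `|d2F m x y| <= C2)
  (U : Rd R d -> R) (pi : density R d)
  (hpi : exists2 Z : R, 0 < Z &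
    forall x, pi x = Z^-1 * expR (- (2 / sigma ^+ 2) * U x))
  (m0 : density R d) (R0 : R) (hR0 : 1 < R0)
  (hm0 : (ereal_sup (range (fun x => (m0 x / pi x)%:E)) <= R0%:E)%E) :
  exists m : R -> density R d,
  [/\ birth_death_solution sigma dF pi m0 m,
      forall m' : R -> density R d, birth_death_solution sigma dF pi m0 m' ->
        forall t x, 0 <= t -> m' t x = m t x,
      forall t, 0 <= t ->
        (KL (m t) pi <= (2 * ln R0 + 4 * C / sigma ^+ 2)%:E)%E,
      exists2 R1 : R, 1 < R1 & forall t, 0 <= t ->
        (ereal_sup (range (fun x => (m t x / pi x)%:E)) <= R1%:E)%E &
      forall r : R, 0 < r ->
        (r%:E <= ereal_inf (range (fun x => (m0 x / pi x)%:E)))%E ->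
        exists2 r1 : R, 0 < r1 & forall t, 0 <= t ->
          (r1%:E <= ereal_inf (range (fun x => (m t x / pi x)%:E)))%E].
Proof.
pose c := sigma ^+ 2 / 2.
have c0 : 0 < c by rewrite divr_gt0// exprn_gt0.
have R01 := ltW hR0.
have R0_gt0 : 0 < R0 by rewrite (lt_trans _ hR0).
have [_ mdF _ _ mean0] := hdF.
have pi_gt0 x : 0 < pi x.
  by have [Z Z0 ->] := hpi; rewrite mulr_gt0 ?invr_gt0 ?expR_gt0.
have dF_tv (m m' : density R d) x :
    `|dF (density_prob m') x - dF (density_prob m) x|
      <= C2 * \int[lebesgue_rV R d]_x `|m' x - m x|.
  exact: (flat_derivative_tv_lipschitz (hd2F x) (fun m a' => hd2FC2 m a' x)).
have dF_mean (m : density R d) :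
    \int[lebesgue_rV R d]_x (dF (density_prob m) x * m x) = 0.
  rewrite /Rintegral -(integral_density_prob _ (mdF _) (hdFC _)).
  by rewrite mean0.
have m0R x : m0 x / pi x <= R0.
  by rewrite -lee_fin; apply: le_trans hm0; apply: ereal_sup_ubound; exists x.
have [m [m0E mode mR mr]] := birth_death_path_exists c0 (ltW hC) (ltW hC2) R01
  pi_gt0 mdF hdFC dF_tv dF_mean m0R.
pose M := R0 ^+ 2 * expR (2 * (C / c)).
have Cc : 0 <= C / c by rewrite divr_ge0 ?ltW.
have M1 : 1 < M.
  apply: (@lt_le_trans _ _ (R0 ^+ 2)); first by rewrite exprn_egt1.
  by rewrite ler_peMr ?sqr_ge0// -expR0 ler_expR mulr_ge0.
have lnM : ln M = 2 * ln R0 + 4 * C / sigma ^+ 2.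
  rewrite lnM ?posrE ?exprn_gt0 ?expR_gt0// lnXn// expRK.
  rewrite -[ln R0 *+ 2]mulr_natl; congr (_ + _).
  by rewrite /c; field; rewrite gt_eqF.
have KLm t (t0 : 0 <= t) : (KL (m t) pi <= (ln M)%:E)%E.
  by apply: (KL_le_ln pi_gt0 (ltW M1)) => x; exact: mR.
exists m; split.
- split; first exact: m0E.
    by move=> t t0; exact: le_lt_trans (KLm t t0) (ltry _).
  by move=> t x t0; exact: mode.
- move=> m' [m'0 _ m'ode] t x t0.
  apply: (flow_unique c0 (ltW hC) (ltW hC2) pi_gt0 hdFC dF_tv
    (k := fun t => fine (KL (m t) pi)) (k' := fun t => fine (KL (m' t) pi))) => //.
  by move=> y; rewrite m'0 m0E.
- by move=> t t0; rewrite -lnM; exact: KLm.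
- exists M => // t t0; apply: ge_ereal_sup => _ [x _ <-].
  by rewrite lee_fin; exact: mR.
- move=> r r0 hr.
  (* The lower bound needs a number at most 1: only then do powers with exponent
     at most 1 not decrease it. *)
  pose r' := Num.min r 1.
  have r'01 : 0 < r' <= 1 by rewrite lt_min r0 ltr01 ge_min lexx orbT.
  have rg x : r' <= m0 x / pi x.
    rewrite (@le_trans _ _ r) ?ge_min ?lexx// -lee_fin; apply: le_trans hr _.
    by apply: ereal_inf_lbound; exists x.
  exists (r' * expR (- (C / c)) / (R0 * expR (C / c))).
    by case/andP : r'01 => r'0 _; rewrite divr_gt0 ?mulr_gt0 ?expR_gt0.
  move=> t t0; apply: le_ereal_inf_tmp => _ [x _ <-].
  by rewrite lee_fin; exact: mr.
Qed.
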